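(* Let $\mathcal{I}:I\to\mathbb{R}$ be a $d$-dimensional grayscale digital image, let $N>\max_{p\in I}\mathcal{I}(p)$, and let $\mathcal{I}^{\mathbf{P}}$ be the image padded with the value $N$. Then, as multisets of intervals labelled by homological degree, $$\mathsf{Dgm}_{\mathbf F}(V(\mathcal{I}))=\{\,[-q,-p)_{d-k-1}\mid [p,q)_k\in\mathsf{Dgm}_{\mathbf F}(T(-\mathcal{I}^{\mathbf P}))\,\}\setminus\{\,[\min\mathcal{I},N)_0\,\}$$ and $$\mathsf{Dgm}_\infty(V(\mathcal{I}))=\{\,[\min\mathcal{I},\infty)_0\,\}.$$
   Context: A $d$-dimensional grayscale digital image ($d\ge 1$) is a function $\mathcal{I}:I\to\mathbb{R}$ with $I=\{1,\dots,n_1\}\times\dots\times\{1,\dots,n_d\}$. For a real $N>\max\mathcal{I}$, the padded image $\mathcal{I}^{\mathbf P}:I^{\mathbf P}\to\mathbb{R}$ has domain $I^{\mathbf P}=\{0,\dots,n_1+1\}\times\dots\times\{0,\dots,n_d+1\}$, with $\mathcal{I}^{\mathbf P}(p)=\mathcal{I}(p)$ for $p\in I$ and $\mathcal{I}^{\mathbf P}(p)=N$ for $p\in I^{\mathbf P}\setminus I$. $-\mathcal{I}^{\mathbf P}$ is its pointwise negative. An elementary $k$-cube in $\mathbb{R}^d$ is a product of $d$ intervals, $k$ of the form $[l,l+1]$ and $d-k$ degenerate $[l,l]$. For cells, $\tau\preceq\sigma$ means $\tau$ is a face of $\sigma$. V-construction: for an image $\mathcal{J}:J\to\mathbb{R}$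 on a grid $J$ of size $(m_1,\dots,m_d)$, $V(J)$ is the cubical complex of the array of $(m_1-1)\times\dots\times(m_d-1)$ elementary $d$-cubes and all their faces, whose vertices are indexed exactly by $J$ (the unit-cube subdivision of the box spanned by $J$). The function $V(\mathcal{J})$ equals $\mathcal{J}(p)$ on the vertex indexed by $p$, and on a cube $\sigma$ equals the maximum of its values on the vertices of $\sigma$. T-construction: $T(J)$ is the cubical complex of the array of $m_1\times\dots\times m_d$ elementary $d$-cubes and all their faces, whose $d$-cubes are indexed exactly by $J$ (up to translation, the cube indexed by $p$ is $\prod_i[p_i-\frac12,p_i+\frac12]$). The function $T(\mathcal{J})$ equals $\mathcal{J}(p)$ on the $d$-cube indexed by $p$, and on a cube $\sigma$ equals the minimum of its values on the $d$-cubes having $\sigma$ as a face. Persistence diagrams: for a function $f:X\to\mathbb{R}$ on the cells of a finite cell complex with $f(\sigma)\le f(\tau)$ whenever $\sigma\preceq\tau$, the sub-level sets $f^{-1}(-\infty,r]$ are subcomplexes, and the functor $H_k(f):r\mapsto H_k(f^{-1}(-\infty,r];\mathbb{Z}/2\mathbb{Z})$ on the poset $(\mathbb{R},\le)$ decomposes as a direct sum of interval modules $\mathbb{I}_{[b_l,d_l)}$, $l \in L$ ($\mathbb{Z}/2\mathbb{Z}$ on $[b_l,d_l)$ with identity maps, $0$ elsewhere), with $d_l\in\mathbb{R}\cup\{\infty\}$. $\mathsf{Dgm}^k(f)$ is the multiset of intervals $[b_l,d_l)$ so obtained, also written $[b_l,d_l)_k$, and $\mathsf{Dgm}(f)=\bigsqcup_k\mathsf{Dgm}^k(f)$.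 $\mathsf{Dgm}_{\mathbf F}(f)$ is the sub-multiset of finite intervals ($d_l<\infty$) and $\mathsf{Dgm}_\infty(f)$ that of the intervals with $d_l=\infty$. Empty intervals are neglected. The set operation $\setminus$ and the set-builder notation are to be read for multisets (removing one copy). $\mathsf{Dgm}(V(\mathcal{I}))$ is the diagram of the function $V(\mathcal{I})$ on $V(I)$, and $\mathsf{Dgm}(T(-\mathcal{I}^{\mathbf P}))$ is that of $T(-\mathcal{I}^{\mathbf P})$ on $T(I^{\mathbf P})$. *)

(* Defs.v *)
From HB Require Import structures.
From mathcomp Require Import all_boot all_order all_algebra.
From mathcomp Require Import ring_quotient.
From mathcomp Require Import boolp classical_sets reals constructive_ereal.

Set Implicit Arguments.
Unset Strict Implicit.
Unset Printing Implicit Defensive.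

Import Order.TTheory GRing.Theory Num.Theory.
Local Open Scope ring_scope.
Local Open Scope quotient_scope.

Section QuotientSpace.
Variables (K : fieldType) (V : vectType K) (U : {vspace V}).

Definition quotv : Type := Quotient.quot (pred_of_vspace U).
HB.instance Definition _ :=
  ZmodQuotient.copy quotv (Quotient.quot (pred_of_vspace U)).

Lemma quotv_eqP (x y : V) : (\pi_quotv x = \pi_quotv y) <-> (x - y \in U).
Proof.
rewrite -[x - y \in U]/(x - y \in pred_of_vspace U) Quotient.idealrBE.
by split=> /eqP.
Qed.

Lemma quotv_repr (x : V) : repr (\pi_quotv x) - x \in U.
Proof. by apply/quotv_eqP; rewrite reprK. Qed.

Definition quotv_scale (a : K) (x : quotv) : quotv := \pi_quotv (a *: repr x).

Lemma quotv_scale_pi a (x : V) :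
  quotv_scale a (\pi_quotv x) = \pi_quotv (a *: x).
Proof. by apply/quotv_eqP; rewrite -scalerBr memvZ ?quotv_repr. Qed.

Fact quotv_scaleA a b x : quotv_scale a (quotv_scale b x) = quotv_scale (a * b) x.
Proof. by elim/quotW: x => x; rewrite (quotv_scale_pi b) !quotv_scale_pi scalerA. Qed.
Fact quotv_scale1 : left_id 1 quotv_scale.
Proof. by elim/quotW => x; rewrite quotv_scale_pi scale1r. Qed.
Fact quotv_scaleDr : right_distributive quotv_scale +%R.
Proof.
move=> a; elim/quotW => x; elim/quotW => y.
by rewrite -raddfD !quotv_scale_pi -raddfD -scalerDr.
Qed.
Fact quotv_scaleDl x : {morph quotv_scale^~ x : a b / a + b}.
Proof.
by elim/quotW: x => x a b; rewrite !quotv_scale_pi -raddfD -scalerDl.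
Qed.

HB.instance Definition _ := GRing.Zmodule_isLmodule.Build K quotv
  quotv_scaleA quotv_scale1 quotv_scaleDr quotv_scaleDl.

Fact quotv_pi_linear : linear (\pi_quotv : V -> quotv).
Proof.
by move=> a x y; rewrite raddfD; congr (_ + _); apply/esym/quotv_scale_pi.
Qed.

End QuotientSpace.

Section QuotientMap.
Variables (K : fieldType) (V W : vectType K).
Variables (U : {vspace V}) (U' : {vspace W}) (g : 'Hom(V, W)).

Definition quotv_map of (g @: U <= U')%VS : quotv U -> quotv U' :=
  fun x => \pi_(quotv U') (g (repr x)).

Lemma quotv_mapE (gU : (g @: U <= U')%VS) (x : V) :
  quotv_map gU (\pi_(quotv U) x) = \pi_(quotv U') (g x).
Proof.
apply/quotv_eqP; rewrite -linearB /=.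
by apply: (subvP gU); rewrite memv_img ?quotv_repr.
Qed.

Fact quotv_map_linear (gU : (g @: U <= U')%VS) : linear (quotv_map gU).
Proof.
move=> a; elim/quotW => x; elim/quotW => y.
by rewrite -quotv_pi_linear !quotv_mapE -quotv_pi_linear linearP.
Qed.

HB.instance Definition _ (gU : (g @: U <= U')%VS) :=
  GRing.isLinear.Build K (quotv U) (quotv U') _ (quotv_map gU)
    (quotv_map_linear gU).

End QuotientMap.

Section PersistenceModules.
Variable R : realType.

Record pmod := PMod {
  pm_obj :> R -> lmodType 'F_2;
  pm_map : forall r s, r <= s -> {linear pm_obj r -> pm_obj s};
  pm_map_id : forall r (h : r <= r) x, pm_map h x = x;
  pm_map_comp : forall r s t (h1 : r <= s) (h2 : s <= t) (h : r <= t) x,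
    pm_map h2 (pm_map h1 x) = pm_map h x }.

Definition pm_iso (M N : pmod) : Prop :=
  exists phi : forall r, {linear M r -> N r},
    (forall r, bijective (phi r)) /\
    (forall r s (h : r <= s) x,
       phi s (pm_map M h x) = pm_map N h (phi r x)).

Section Zero.
Let obj (r : R) : lmodType 'F_2 := 'rV['F_2]_0.
Let map r s (_ : r <= s) : {linear obj r -> obj s} := idfun.
Definition pm_zero : pmod := @PMod obj map (fun _ _ _ => erefl)
  (fun _ _ _ _ _ _ _ => erefl).
End Zero.

Section Sum.
Variables M N : pmod.
Let obj (r : R) : lmodType 'F_2 := (M r * N r)%type.
Let fn r s (h : r <= s) (x : obj r) : obj s :=
  (pm_map M h x.1, pm_map N h x.2).
Fact pm_add_linear r s (h : r <= s) : linear (fn h).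
Proof. by move=> a x y; rewrite /fn /= !linearP. Qed.
HB.instance Definition _ r s (h : r <= s) :=
  GRing.isLinear.Build 'F_2 (obj r) (obj s) _ (fn h) (pm_add_linear h).
Let map r s (h : r <= s) : {linear obj r -> obj s} := fn h.
Fact pm_add_id r (h : r <= r) x : map h x = x.
Proof. by case: x => x y; rewrite /map /= /fn !pm_map_id. Qed.
Fact pm_add_comp r s t (h1 : r <= s) (h2 : s <= t) (h : r <= t) x :
  map h2 (map h1 x) = map h x.
Proof.
by rewrite /map /= /fn /= (pm_map_comp h1 h2 h) (pm_map_comp h1 h2 h).
Qed.
Definition pm_add : pmod := PMod pm_add_id pm_add_comp.
End Sum.

Definition pm_sum (s : seq pmod) : pmod := foldr pm_add pm_zero s.

(** A bar [b, d) is encoded as the pair (b, d) with d in the extended reals. *)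
Definition bar : Type := (R * \bar R)%type.

Definition in_bar (I : bar) (r : R) : bool :=
  (I.1 <= r) && (r%:E < I.2)%E.

Lemma pid_mx_bool (a : bool) : pid_mx 1 = 1%:M :> 'M['F_2]_a.
Proof. by case: a; rewrite ?pid_mx_1 // flatmx0 [RHS]flatmx0. Qed.

Lemma pid_mx_boolM (a b c : bool) : (a -> c -> b) ->
  (pid_mx 1 : 'M['F_2]_(a, b)) *m (pid_mx 1 : 'M_(b, c)) = pid_mx 1.
Proof.
case: a => [|_]; last by rewrite [LHS]flatmx0 [RHS]flatmx0.
case: c => [|_]; last by rewrite [LHS]thinmx0 [RHS]thinmx0.
by move=> /(_ isT isT) ->; rewrite mul_pid_mx.
Qed.

(** The space at r has dimension [in_bar I r : bool] coerced to 0 or 1, so that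
    [pid_mx 1] is the identity when both ends are one-dimensional and is an
    empty matrix otherwise. *)
Section IntervalModule.
Variable I : bar.
Let obj (r : R) : lmodType 'F_2 := 'rV['F_2]_(in_bar I r).
Let map r s (_ : r <= s) : {linear obj r -> obj s} :=
  mulmxr (pid_mx 1 : 'M['F_2]_(in_bar I r, in_bar I s)).
Fact pm_interval_id r (h : r <= r) x : map h x = x.
Proof.
by rewrite /map /= pid_mx_bool mulmx1.
Qed.
Fact pm_interval_comp r s t (h1 : r <= s) (h2 : s <= t) (h : r <= t) x :
  map h2 (map h1 x) = map h x.
Proof.
rewrite /map /= -mulmxA pid_mx_boolM // => /andP[Ir _] /andP[_ It].
rewrite /in_bar (le_trans Ir h1) /=.
by apply: le_lt_trans It; rewrite lee_fin.
Qed.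
Definition pm_interval : pmod := PMod pm_interval_id pm_interval_comp.
End IntervalModule.

End PersistenceModules.

Section FiniteExtrema.
Variables (R : realType) (T : finType).

(** Both are 0 by convention when no element satisfies [P]. *)
Definition fmax (P : pred T) (F : T -> R) : R :=
  if [pick x | P x] is Some x0 then \big[Num.max/F x0]_(x | P x) F x else 0.

Definition fmin (P : pred T) (F : T -> R) : R :=
  if [pick x | P x] is Some x0 then \big[Num.min/F x0]_(x | P x) F x else 0.

End FiniteExtrema.

Section CubicalComplex.
Variables (d : nat) (m : 'I_d -> nat).

(** Elementary intervals between consecutive points of [0, ..., k - 1]:
    [inl l] is the degenerate [l, l] and [inr l] is [l, l + 1]. *)
Definition elem_itv (k : nat) : finType := ('I_k + 'I_k.-1)%type.

Definition itv_lo k (e : elem_itv k) : nat :=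
  match e with inl l => l | inr l => l end.

Definition itv_hi k (e : elem_itv k) : nat :=
  match e with inl l => l | inr l => l.+1 end.

(** All elementary cubes in the product over [i] of the real intervals from
    0 to [m i - 1]. *)
Definition cube : finType := {dffun forall i : 'I_d, elem_itv (m i)}.

Definition cube_dim (s : cube) : nat :=
  #|[set i | itv_lo (s i) != itv_hi (s i)]|.

Definition face (t s : cube) : bool :=
  [forall i, (itv_lo (s i) <= itv_lo (t i))%N &&
             (itv_hi (t i) <= itv_hi (s i))%N].

Definition chain : vectType 'F_2 := {ffun cube -> ('F_2)^o}.

Definition cell_chain (s : cube) : chain := [ffun t => (t == s)%:R].

Definition boundary_fun (c : chain) : chain :=
  [ffun t => \sum_(s | face t s && (cube_dim s == (cube_dim t).+1)) c s].

Fact boundary_linear : linear boundary_fun.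
Proof.
move=> a x y; apply/ffunP => t; rewrite !ffunE scaler_sumr -big_split /=.
by apply: eq_bigr => s _; rewrite !ffunE.
Qed.
HB.instance Definition _ :=
  GRing.isLinear.Build 'F_2 chain chain _ boundary_fun boundary_linear.

Definition boundary : 'End(chain) := linfun boundary_fun.

Section Filtration.
Variables (R : realType) (f : cube -> R).

(** The definitions below compute the homology of the sub-level sets of [f]
    when [f] is monotone with respect to [face], so that these sets are
    subcomplexes. *)

(** Degrees are integers, so that the homology in negative degree is zero. *)
Definition sublevel_cells (k : int) (r : R) : {set cube} :=
  [set s | ((cube_dim s)%:Z == k) && (f s <= r)].

Definition sublevel_chains (k : int) (r : R) : {vspace chain} :=
  <<[seq cell_chain s | s in sublevel_cells k r]>>%VS.

Definition cycles (k : int) (r : R) : {vspace chain} :=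
  (lker boundary :&: sublevel_chains k r)%VS.

Definition boundaries (k : int) (r : R) : {vspace chain} :=
  (boundary @: sublevel_chains (k + 1) r)%VS.

Lemma sublevel_chainsS k r s :
  r <= s -> (sublevel_chains k r <= sublevel_chains k s)%VS.
Proof.
move=> rs; apply: sub_span => c /mapP[s0 s0r ->]; apply: map_f.
move: s0r; rewrite !mem_enum !inE => /andP[-> /=] /le_trans; exact.
Qed.

Lemma cyclesS k r s : r <= s -> (cycles k r <= cycles k s)%VS.
Proof. by move=> rs; rewrite capvS ?sublevel_chainsS. Qed.

Lemma boundariesS k r s : r <= s -> (boundaries k r <= boundaries k s)%VS.
Proof. by move=> rs; rewrite limgS ?sublevel_chainsS. Qed.

Section Homology.
Variable k : int.

Definition bounding (r : R) : {vspace subvs_of (cycles k r)} :=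
  (linfun vsval @^-1: boundaries k r)%VS.

Lemma mem_bounding r (z : subvs_of (cycles k r)) :
  (z \in bounding r) = (vsval z \in boundaries k r).
Proof. by rewrite -memv_preim lfunE. Qed.

Definition homology (r : R) : lmodType 'F_2 := quotv (bounding r).

Definition cycle_incl (r s : R) :
    'Hom(subvs_of (cycles k r), subvs_of (cycles k s)) :=
  linfun (vsproj (cycles k s) \o vsval).

Lemma cycle_inclE r s (z : subvs_of (cycles k r)) :
  r <= s -> vsval (cycle_incl r s z) = vsval z.
Proof.
by move=> rs; rewrite lfunE /= vsprojK // (subvP (cyclesS k rs)) ?subvsP.
Qed.

Lemma cycle_incl_bounding r s :
  r <= s -> (cycle_incl r s @: bounding r <= bounding s)%VS.
Proof.
move=> rs; apply/subvP => _ /memv_imgP[z zB ->].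
move: zB; rewrite !mem_bounding cycle_inclE //.
exact: (subvP (boundariesS k rs)).
Qed.

Definition homology_map r s (rs : r <= s) : {linear homology r -> homology s} :=
  quotv_map (cycle_incl_bounding rs).

Fact homology_map_id r (h : r <= r) (x : homology r) : homology_map h x = x.
Proof.
elim/quotW: x => x; rewrite /homology_map /= quotv_mapE; congr (\pi _).
by apply: val_inj; rewrite /= cycle_inclE.
Qed.

Fact homology_map_comp r s t (h1 : r <= s) (h2 : s <= t) (h : r <= t)
    (x : homology r) : homology_map h2 (homology_map h1 x) = homology_map h x.
Proof.
elim/quotW: x => x; rewrite /homology_map /=.
rewrite (quotv_mapE _ x) (quotv_mapE _ (cycle_incl r s x)) (quotv_mapE _ x).
congr (\pi _).
by apply: val_inj; rewrite /= !cycle_inclE.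
Qed.

Definition sublevel_homology : pmod R :=
  PMod homology_map_id homology_map_comp.

End Homology.

(** [D] lists, with their homological degrees, the nonempty bars of interval
    decompositions of the sub-level homology in all degrees. *)
Definition is_dgm (D : seq (int * bar R)) : Prop :=
  (forall x, x \in D -> (x.2.1%:E < x.2.2)%E) /\
  (forall k : int, pm_iso (sublevel_homology k)
     (pm_sum [seq pm_interval x.2 | x <- D & x.1 == k])).

(** The multiset is represented by a sequence, to be compared only up to
    [perm_eq]; it is pinned down by [is_dgm] up to permutation. *)
Definition Dgm : seq (int * bar R) := xget [::] is_dgm.

Definition Dgm_fin : seq (int * bar R) := [seq x <- Dgm | (x.2.2 < +oo)%E].

Definition Dgm_inf : seq (int * bar R) := [seq x <- Dgm | x.2.2 == +oo%E].

End Filtration.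
End CubicalComplex.

Section Images.
Variable d : nat.

(** Pixel coordinates start at 0: the grid of size [n] is the product of the
    [{0, ..., n i - 1}]. *)
Definition grid (n : 'I_d -> nat) : finType := {dffun forall i : 'I_d, 'I_(n i)}.

Definition padded_size (n : 'I_d -> nat) : 'I_d -> nat := fun i => (n i).+2.

Section Constructions.
Variables (R : realType) (n : 'I_d -> nat).

(** The pixel [q] of the grid sits at [q + (1, ..., 1)] in the padded grid. *)
Definition pad (N : R) (J : grid n -> R) (p : grid (padded_size n)) : R :=
  if [pick q : grid n | [forall i, p i == (q i).+1 :> nat]] is Some q
  then J q else N.

Definition V_cube : finType := cube n.

Definition V_vertex (p : grid n) : V_cube := [ffun i => inl (p i)].

Definition V_fun (J : grid n -> R) (s : V_cube) : R :=
  fmax (fun p => face (V_vertex p) s) J.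

Definition T_cube : finType := cube (fun i => (n i).+1).

Definition T_top (p : grid n) : T_cube := [ffun i => inr (p i)].

Definition T_fun (J : grid n -> R) (s : T_cube) : R :=
  fmin (fun p => face s (T_top p)) J.

End Constructions.
End Images.

(* Main.v *)
(** Idea.  By the interval decomposition theorem a diagram is determined by the
    ranks of the maps H_k(f <= r) -> H_k(f <= s), which are
    dim Z_k(r) - dim (Z_k(r) cap B_k(s)).  Moreover
    dim (Z_k(r) cap B_k(s)) = rank D(s, -oo) - rank D(s, r), where D(s, r) is the
    submatrix of the boundary matrix with columns {f <= s} and rows {f > r}.
    The cells of V(I) are dual to the cells of T(I^P) outside the shell of padding
    pixels, duality reverses faces, and it turns T(-I^P) into -V(I), so that these
    submatrices for V(I) are the transposes of those for T(-I^P) as long as r >= -N.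
    What is left is to compare the cycles carried by the shell {T(-I^P) = -N}: since
    V(I) has no cohomology in positive degrees, such a reduced cycle bounds already
    inside the shell, except for the sphere of dimension d - 1, which is filled
    when the last d-cube enters, at -min I; this is the bar dual to [min I, N)_0. *)
Require Import Defs.
From HB Require Import structures.
From mathcomp Require Import all_boot all_order all_algebra.
From mathcomp Require Import ring_quotient zify.
From mathcomp Require Import boolp classical_sets reals constructive_ereal.

Set Implicit Arguments.
Unset Strict Implicit.
Unset Printing Implicit Defensive.

Import Order.TTheory GRing.Theory Num.Theory.
Local Open Scope ring_scope.

(** * Ranks of maps of persistence modules *)

(** Negation turns a half-open bar [p, q) into (-q, -p], closed at the wrong end. As only finitely
    many values occur, the levels -s and -r are replaced by levels [u] and [v] just below them; the
    finite T-bars alive on [u, v] are then, after the flip, those alive on [r, s]. Only ranks are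
    compared, so neither relative homology nor duality of manifolds is involved, and over F_2
    transposing a boundary matrix costs no signs. [Dgm] is chosen among the lists that satisfy
    [is_dgm], so a diagram must also be shown to exist: it comes from one basis of the cycles
    adapted to the cycle and the boundary filtrations at once. That the box is acyclic is proved by
    an explicit homotopy on cochains, and the statement about cycles follows by orthogonality. *)

Definition is_rank (K : fieldType) (U V : lmodType K) (f : U -> V) (n : nat) :=
  exists (W : vectType K) (p : {linear U -> W}),
    [/\ \dim {:W} = n, forall w, exists x, p x = w &
        forall x, p x = 0 <-> f x = 0].

Section Rank.
Variable K : fieldType.

(** Homology spaces are plain [lmodType]s without a dimension, so [is_rank] certifies the rank by a
    finite-dimensional model [W] of the coimage. Two models compare by lifting along [p] and
    applying [p']; this is linear and injective because [p] and [p'] have the same kernel. *)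
Lemma is_rank_leq (U V : lmodType K) (f : U -> V) n n' :
  is_rank f n -> is_rank f n' -> (n <= n')%N.
Proof.
case=> W [p [<- sp kp]] [W' [p' [<- sp' kp']]].
pose g w := sval (cid (sp w)).
have gK w : p (g w) = w by rewrite /g; case: cid.
pose h w := p' (g w).
have hL : linear h.
  move=> a x y; apply/eqP; rewrite /h -subr_eq0 -!linearP -linearB.
  by apply/eqP/kp'/kp; rewrite linearB linearP !gK subrr.
pose hl : {linear W -> W'} := HB.pack h (GRing.isLinear.Build _ _ _ _ h hL).
have ker0 : lker (linfun hl) == 0%VS.
  rewrite -subv0; apply/subvP => w; rewrite memv_ker memv0 lfunE /= => /eqP.
  by move/kp'/kp; rewrite gK => /eqP.
have <- := limg_dim_eq (f := linfun hl) (U := fullv) _.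
  exact/dimvS/subvf.
by rewrite (eqP ker0) capv0.
Qed.

Lemma is_rank_inj (U V : lmodType K) (f : U -> V) n n' :
  is_rank f n -> is_rank f n' -> n = n'.
Proof.
by move=> fn fn'; apply/eqP; rewrite eqn_leq !(is_rank_leq fn fn') // (is_rank_leq fn' fn).
Qed.

End Rank.

Section PersistenceRank.
Variable R : realType.

Lemma pm_iso_rank (M N : pmod R) r s (h : r <= s) n :
  pm_iso M N -> is_rank (pm_map N h) n -> is_rank (pm_map M h) n.
Proof.
case=> phi [bphi nat_phi] [W [p [dW sp kp]]].
exists W, (p \o phi r : {linear _ -> _}); split=> //= [w|x].
  have [y <-] := sp w; have [g _ gK] := bphi r.
  by exists (g y); rewrite /= gK.
rewrite kp -nat_phi; split=> [|->]; last by rewrite linear0.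
by rewrite -(linear0 (phi s)) => /(bij_inj (bphi s)).
Qed.

Lemma pm_interval_rank (I : bar R) r s (h : r <= s) :
  is_rank (pm_map (pm_interval I) h) (in_bar I r && in_bar I s).
Proof.
rewrite /=; move: (in_bar I r) (in_bar I s) => a b.
exists 'rV['F_2]_(a && b), (mulmxr (pid_mx 1 : 'M['F_2]_(a, a && b))); split.
- by rewrite dimvf /dim /= mul1n.
- case: a => w; first by exists (w *m pid_mx 1); case: b w => w /=;
    rewrite ?[RHS]thinmx0 ?[LHS]thinmx0 // pid_mx_1 !mulmx1.
  by exists 0; rewrite [RHS]thinmx0 [LHS]thinmx0.
- case: a; case: b => x //; split=> _; try exact: thinmx0.
  by rewrite /= (thinmx0 x) mul0mx.
Qed.

Lemma pm_add_rank (M N : pmod R) r s (h : r <= s) m n :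
  is_rank (pm_map M h) m -> is_rank (pm_map N h) n ->
  is_rank (pm_map (pm_add M N) h) (m + n).
Proof.
case=> W [p [dW sp kp]] [W' [p' [dW' sp' kp']]].
pose q (x : pm_add M N r) : W * W' := (p x.1, p' x.2).
have qL : linear q by move=> a x y; rewrite /q /= !linearP.
pose ql : {linear pm_add M N r -> (W * W')%type} :=
  HB.pack q (GRing.isLinear.Build _ _ _ _ q qL).
exists (W * W')%type, ql; split.
- by rewrite -dW -dW' !dimvf /dim /=.
- case=> w w'; have [x <-] := sp w; have [x' <-] := sp' w'.
  by exists (x, x').
- case=> x x'; split=> /=.
    by case=> /kp e1 /kp' e2; rewrite e1 e2.
  by case=> /kp e1 /kp' e2; rewrite /q /= e1 e2.
Qed.

Lemma pm_sum_rank (D : seq (bar R)) r s (h : r <= s) :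
  is_rank (pm_map (pm_sum [seq pm_interval x | x <- D]) h)
    (count (fun x => in_bar x r && in_bar x s) D).
Proof.
elim: D => [|I D IH]; last exact: (pm_add_rank (pm_interval_rank I h) IH).
exists 'rV['F_2]_0, idfun; split=> //; first by rewrite dimvf /dim /= muln0.
by move=> w; exists w.
Qed.

End PersistenceRank.

Section Homology.
Local Open Scope quotient_scope.
Variables (R : realType) (d : nat) (m : 'I_d -> nat) (f : cube m -> R).

Lemma homology_rank k r s (h : r <= s) :
  is_rank (pm_map (sublevel_homology f k) h)
    (\dim (cycles f k r) - \dim (cycles f k r :&: boundaries f k s)).
Proof.
set Z := cycles f k r; set B := boundaries f k s.
(* [q] is a projection with kernel exactly [B], so the image of [Z] under it is a model of Z / (Z
   cap B). *)
pose q : 'End(chain m) := (\1 - projv B)%VF.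
have kq : lker q = B.
  apply/eqP; rewrite eqEsubv; apply/andP; split; apply/subvP => x.
    rewrite memv_ker /q !lfunE /= lfunE /= opp_lfunE subr_eq0 => /eqP ->.
    exact: memv_proj.
  by move=> xB; rewrite memv_ker /q !lfunE /= lfunE /= opp_lfunE projv_id ?subrr.
pose W := subvs_of (q @: Z)%VS.
pose p (x : homology f k r) : W := vsproj (q @: Z)%VS (q (vsval (repr x))).
have pE (x : homology f k r) : vsval (p x) = q (vsval (repr x)).
  by rewrite vsprojK // memv_img // subvsP.
have p_pi (z : subvs_of Z) : vsval (p (\pi z)) = q (vsval z).
  rewrite pE; apply/eqP; rewrite -subr_eq0 -linearB /= -memv_ker kq.
  have := quotv_repr (bounding f k r) z; rewrite mem_bounding.
  exact: (subvP (boundariesS f k h)).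
have pL : linear p.
  move=> a x y; elim/quotW: x => x; elim/quotW: y => y; apply: val_inj.
  rewrite /= -quotv_pi_linear !p_pi.
  by have -> : vsval (a *: x + y) = a *: vsval x + vsval y by []; rewrite linearP.
pose pl : {linear homology f k r -> W} := HB.pack p (GRing.isLinear.Build _ _ _ _ p pL).
exists W, pl; split.
- by rewrite dimvf /dim /= -kq -(limg_ker_dim q Z) addnC addnK.
- move=> w; have /memv_imgP[z zZ wE] := subvsP w.
  exists (\pi_(quotv (bounding f k r)) (vsproj Z z)); apply: val_inj.
  by rewrite /= p_pi vsprojK.
- move=> x; elim/quotW: x => z.
  transitivity (q (vsval z) = 0).
    split=> [/(congr1 vsval)|e]; first by rewrite p_pi.
    by apply: val_inj; rewrite /= p_pi e.
  rewrite /= /homology_map /= quotv_mapE.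
  have -> : (\pi_(quotv (bounding f k s)) (cycle_incl f k r s z) = 0) <->
            cycle_incl f k r s z \in bounding f k s.
    have <- : \pi_(quotv (bounding f k s)) 0 = 0 := raddf0 _.
    by rewrite quotv_eqP subr0.
  rewrite mem_bounding cycle_inclE // -/B -kq memv_ker.
  by split=> /eqP.
Qed.

End Homology.

Lemma count_addn (T : eqType) (p p1 p2 : pred T) (s : seq T) :
  {in s, forall x, p x = (p1 x + p2 x)%N :> nat} ->
  count p s = (count p1 s + count p2 s)%N.
Proof.
elim: s => //= x s IH pE; rewrite addnACA -pE ?mem_head // IH // => y ys.
by apply: pE; rewrite inE ys orbT.
Qed.

(** * Recovering the bars from the ranks *)

Section Bars.
Variable R : realType.
Implicit Types (L : seq R) (D : seq (int * bar R)).

(** Makes [u] a level just before [t]: on entries of [L], the conditions x <= u and x < t agree. *)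
Lemma seq_gap L (a t : R) : a < t ->
  exists u, [/\ a <= u, u < t & {in L, forall x, x < t -> x <= u}].
Proof.
move=> lt_at; elim: L => [|x L [u [au ut uL]]]; first by exists a.
have [xt|tx] := ltP x t.
  exists (Num.max x u); split=> [||y]; first by rewrite le_max au orbT.
    by rewrite gt_max xt.
  by rewrite inE le_max => /predU1P[->|yL]; rewrite ?lexx // => /uL ->; rewrite ?orbT.
exists u; split=> // y; rewrite inE => /predU1P[->|/uL //].
by rewrite ltNge tx.
Qed.

Lemma seq_ub L (a : R) : exists u, a <= u /\ {in L, forall x, x <= u}.
Proof.
elim: L => [|x L [u [au uL]]]; first by exists a.
exists (Num.max x u); split=> [|y]; first by rewrite le_max au orbT.
by rewrite inE le_max => /predU1P[->|/uL ->]; rewrite ?lexx ?orbT.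
Qed.

(** For r <= s this means that a bar of degree [k] contains both r and s; the number of such bars is
    the rank from r to s. *)
Definition alive (k : int) (r s : R) (x : int * bar R) : bool :=
  [&& x.1 == k, x.2.1 <= r & (s%:E < x.2.2)%E].

Definition born (k : int) (b s : R) (x : int * bar R) : bool :=
  [&& x.1 == k, x.2.1 == b & (s%:E < x.2.2)%E].

Lemma count_born D k b s r : (forall x, x \in D -> (x.2.1 <= r) = (x.2.1 < b)) ->
  count (alive k b s) D = (count (born k b s) D + count (alive k r s) D)%N.
Proof.
move=> rb; apply: count_addn => x xD; rewrite /alive /born rb //.
by case: (x.1 == k) => //=; case: (_ < _)%E; rewrite ?andbF // !andbT; case: ltgtP.
Qed.

(** Multiplicities are differences of ranks. Comparing starts at [b] and just below [b] isolates the
    bars born at [b]; among these, comparing ends just below [e] and at [e] isolates [b, e). For an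
    infinite bar, a level beyond all finite ends is enough. *)
Lemma bars_perm_eq D D' :
  {in D, forall x, (x.2.1%:E < x.2.2)%E} ->
  {in D', forall x, (x.2.1%:E < x.2.2)%E} ->
  (forall k r s, r <= s -> count (alive k r s) D = count (alive k r s) D') ->
  perm_eq D D'.
Proof.
move=> nD nD' eqDD'; apply/allP => -[k [b e]] xD; apply/eqP.
have lt_be : (b%:E < e)%E by move: xD; rewrite mem_cat => /orP[/nD|/nD'].
have lt_b1b : b - 1 < b by rewrite gtrBl.
have [r0 [_ r0b r0L]] := seq_gap [seq x.2.1 | x <- D ++ D'] lt_b1b.
have r0E x : x \in D ++ D' -> (x.2.1 <= r0) = (x.2.1 < b).
  move=> xDD; apply/idP/idP => [/le_lt_trans -> //|].
  by apply/r0L/map_f.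
have eqb s : b <= s -> count (born k b s) D = count (born k b s) D'.
  move=> bs; apply/eqP; rewrite -(eqn_add2r (count (alive k r0 s) D)).
  rewrite -count_born => [|x xD0]; last by rewrite r0E // mem_cat xD0.
  rewrite !eqDD' // ?(le_trans (ltW r0b)) //.
  by rewrite (@count_born D' k b s r0) // => x xD0; rewrite r0E // mem_cat xD0 orbT.
case: e lt_be xD => [e| |//].
- rewrite lte_fin => lt_be xD.
  (* For infinite ends [fine] adds a spurious 0 to the list, which only makes the gap avoid one more
     value. *)
  have [s1 [bs1 s1e s1L]] := seq_gap [seq fine x.2.2 | x <- D ++ D'] lt_be.
  have mem1 D0 : {subset D0 <= D ++ D'} ->
      count (born k b s1) D0 =
      (count_mem (k, (b, e%:E)) D0 + count (born k b e) D0)%N.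
    move=> sD; apply: count_addn => -[k' [b' e']] /sD/(map_f (fun x => fine x.2.2))/s1L.
    rewrite /born /= -!pair_eqE /pair_eq /= -pair_eqE /pair_eq /=.
    case: (k' == k) (b' == b) => -[] //=.
    case: e' => [e'| |] //=; last by rewrite !ltry.
    rewrite !lte_fin eqe; case: ltgtP => [lt||-> _]; rewrite ?s1e //.
      by move=> /(_ isT); rewrite leNgt => /negbTE ->.
    by move=> lt _; rewrite (lt_trans s1e lt).
  have := eqb s1 bs1; rewrite !mem1 => [|x|x].
  - by rewrite (eqb e (ltW lt_be)) => /addIn.
  - by rewrite mem_cat orbC => ->.
  - by rewrite mem_cat => ->.
- move=> _ xD; have [s1 [bs1 s1L]] := seq_ub [seq fine x.2.2 | x <- D ++ D'] b.
  have mem1 D0 : {subset D0 <= D ++ D'} ->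
      count (born k b s1) D0 = count_mem (k, (b, +oo%E)) D0.
    move=> sD; apply: eq_in_count => -[k' [b' e']] /sD/(map_f (fun x => fine x.2.2))/s1L.
    rewrite /born /= -!pair_eqE /pair_eq /= -pair_eqE /pair_eq /=.
    case: (k' == k) (b' == b) => -[] //=.
    case: e' => [e'| |] //=; last by rewrite !ltry.
    by rewrite lte_fin ltNge => ->.
  by rewrite -!mem1 ?eqb // => x; rewrite mem_cat => ->; rewrite ?orbT.
Qed.

Section Dgm.
Variables (d : nat) (m : 'I_d -> nat) (f : cube m -> R).

Lemma dgm_count D k r s : is_dgm f D -> r <= s ->
  count (alive k r s) D =
  (\dim (cycles f k r) - \dim (cycles f k r :&: boundaries f k s))%N.
Proof.
case=> _ isoD rs; apply: is_rank_inj (homology_rank f k rs).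
apply: pm_iso_rank (isoD k) _.
have -> : count (alive k r s) D =
  count (fun x : bar R => in_bar x r && in_bar x s) [seq x.2 | x <- D & x.1 == k].
  rewrite count_map count_filter; apply: eq_count => -[k' [b e]] /=.
  rewrite /alive /in_bar /=; case: (k' == k); rewrite ?andbF // andbT /=.
  apply/andP/andP => [[br se]|[/andP[br _] /andP[_ se]] //].
  rewrite br se (le_trans br rs) /= (le_lt_trans _ se) //.
have := @pm_sum_rank R [seq x.2 | x <- D & x.1 == k] r s rs.
by rewrite -map_comp.
Qed.

End Dgm.
End Bars.

(** * Interval decomposition of sub-level homology *)

Section AdaptedBasis.
Variables (K : fieldType) (V : vectType K).
Implicit Types (E : seq V) (U : {vspace V}) (Zs Bs : seq {vspace V}).

(** For a free [E]: the members of [E] lying in [U] form a basis of the intersection of <<E>> and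
    U. *)
Definition adapted E U :=
  forall x, x \in <<E>>%VS -> x \in U -> x \in <<[seq e <- E | e \in U]>>%VS.

Lemma chain_min Bs (P : pred {vspace V}) :
  {in Bs &, forall U U', (U <= U')%VS || (U' <= U)%VS} -> has P Bs ->
  exists U0, [/\ U0 \in Bs, P U0 & {in Bs, forall U, P U -> (U0 <= U)%VS}].
Proof.
elim: Bs => //= U Bs IH tot hP.
have totU : {in Bs, forall U', (U <= U')%VS || (U' <= U)%VS}.
  by move=> U' UBs; apply: tot; rewrite inE ?eqxx ?UBs ?orbT.
have totB : {in Bs &, forall U U', (U <= U')%VS || (U' <= U)%VS}.
  by move=> U1 U2 h1 h2; apply: tot; rewrite inE ?h1 ?h2 orbT.
have [hB|nB] := boolP (has P Bs).
  have [U0 [U0B PU0 minU0]] := IH totB hB.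
  have [UU0|nUU0] := boolP (P U && (U <= U0)%VS).
    have [PU UU0'] := andP UU0.
    exists U; split; rewrite ?mem_head // => U'.
    by rewrite inE => /predU1P[-> //|U'B /(minU0 _ U'B)]; apply: subv_trans.
  exists U0; split=> //; first by rewrite inE U0B orbT.
  move=> U'; rewrite inE => /predU1P[-> PU|]; last exact: minU0.
  by have := totU _ U0B; rewrite PU /= in nUU0; rewrite (negbTE nUU0).
rewrite (negbTE nB) orbF in hP.
exists U; split; rewrite ?mem_head // => U'.
rewrite inE => /predU1P[-> //|U'B PU'].
by case/hasP: nB; exists U'.
Qed.

(* The new vector is moved within its coset modulo [<<E>>] into the smallest
   member of the chain that meets this coset. *)
Lemma adapted_cons E Bs w :
  {in Bs &, forall U U', (U <= U')%VS || (U' <= U)%VS} ->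
  {in Bs, forall U, adapted E U} ->
  exists w', w' - w \in <<E>>%VS /\ {in Bs, forall U, adapted (w' :: E) U}.
Proof.
move=> tot adE; pose P U := w \in (<<E>> + U)%VS.
have [w' [w'w minw']] : exists w', w' - w \in <<E>>%VS /\
    {in Bs, forall U, P U -> w' \in U}.
  have [/(chain_min tot)[U0 [U0B PU0 minU0]]|nP] := boolP (has P Bs).
    have [e eE [u uU0 wE]] := memv_addP PU0.
    exists u; split; first by rewrite wE opprD addrCA subrr addr0 rpredN.
    by move=> U UB PU; apply: (subvP (minU0 _ UB PU)).
  exists w; rewrite subrr mem0v; split=> // U UB PU.
  by case/hasP: nP; exists U.
exists w'; split=> // U UB x; rewrite span_cons => /memv_addP[y /vlineP[a ->]].
case=> e eE -> xU.
have [a0|a0] := eqVneq a 0.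
  rewrite a0 scale0r add0r in xU *; apply: subvP (adE _ UB e eE xU).
  by apply: sub_span => z; rewrite /=; case: ifP => // _ zE; rewrite inE zE orbT.
(* With a nonzero coefficient on [w'], the vector a w' + e of [U] shows that [U] meets the coset of
   [w] modulo <<E>>, so the choice of [w'] puts it in [U]. *)
have w'U : w' \in U.
  apply: minw' => //; apply/memv_addP.
  exists (a^-1 *: - e - (w' - w)); first by rewrite rpredB // memvZ ?rpredN.
  exists (a^-1 *: (a *: w' + e)); first by rewrite memvZ.
  rewrite scalerDr scalerA mulVf // scale1r scalerN.
  by rewrite [w' + _ *: _]addrC addrACA addNr add0r opprB subrK.
rewrite /= w'U span_cons memv_add ?memvZ ?memv_line // adE //.
by rewrite -(addKr (a *: w') e) rpredD // rpredN memvZ.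
Qed.

Lemma adapted_extend E Bs U :
  {in Bs &, forall U U', (U <= U')%VS || (U' <= U)%VS} ->
  {in Bs, forall B, adapted E B} -> free E -> (<<E>> <= U)%VS ->
  exists E', [/\ free (E' ++ E), <<E' ++ E>>%VS = U,
    {in E', forall e, e \notin <<E>>%VS} & {in Bs, forall B, adapted (E' ++ E) B}].
Proof.
move=> tot; move En : (\dim U - \dim <<E>>)%N => n.
elim: n E En => [|n IH] E En adE freeE sEU.
  exists [::]; split=> //=; apply/eqP.
  by rewrite eqEdim sEU /= -subn_eq0 En.
have /subvPn[w wU wE] : ~~ (U <= <<E>>)%VS.
  by apply/negP => /dimvS; rewrite -subn_eq0 En.
have [w' [w'w adw']] := adapted_cons w tot adE.
have w'E : w' \notin <<E>>%VS.
  by apply: contra wE => w'E; rewrite -(rpredBl _ w'E) // rpredB.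
have w'U : w' \in U by rewrite -(subrK w w') rpredD // (subvP sEU).
have freew' : free (w' :: E) by rewrite free_cons w'E.
have sw'U : (<<w' :: E>> <= U)%VS.
  by rewrite span_cons subv_add -memvE w'U.
have dimw' : (\dim U - \dim <<w' :: E>>)%N = n.
  by rewrite (eqP freew') /= subnS -(eqP freeE) En.
have [E' [freeE' spanE' E'E adE']] := IH _ dimw' adw' freew' sw'U.
exists (rcons E' w'); rewrite cat_rcons; split=> // e.
rewrite mem_rcons inE => /predU1P[-> //|/E'E]; apply: contra.
by apply: subvP; rewrite span_cons addvSr.
Qed.

(** Two chains of subspaces have a common adapted basis. The members of [Zs] are filled up one after
    the other by vectors outside the previous span, each chosen so as to stay adapted to [Bs]. *)
Lemma adapted_basis Zs Bs :
  {in Bs &, forall U U', (U <= U')%VS || (U' <= U)%VS} ->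
  sorted (fun U U' => (U <= U')%VS) Zs ->
  exists E, [/\ free E, <<E>>%VS = last 0%VS Zs,
    {in Zs, forall Z : {vspace V}, <<[seq e <- E | e \in Z]>>%VS = Z} &
    {in Bs, forall B, adapted E B}].
Proof.
move=> tot; elim/last_ind: Zs => [|Zs Z IH] sZ.
  exists [::]; rewrite /= span_nil nil_free; split=> // B _ x.
  by rewrite span_nil.
have trS : transitive (fun U U' : {vspace V} => (U <= U')%VS).
  by move=> U1 U2 U3; apply: subv_trans.
have sZs : sorted (fun U U' => (U <= U')%VS) Zs.
  by move: sZ; rewrite -cats1 => /cat_sorted2[].
have [E [freeE spanE EZ adE]] := IH sZs.
have sEZ : (<<E>> <= Z)%VS.
  rewrite spanE; move: sZ; rewrite -cats1.
  case: (Zs) => [|Z0 Zs'] /=; first by rewrite sub0v.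
  by rewrite cat_path /= => /and3P[].
have [E' [freeE' spanE' E'E adE']] := adapted_extend tot adE freeE sEZ.
exists (E' ++ E); split=> //; first by rewrite last_rcons.
move=> Z'; rewrite mem_rcons inE => /predU1P[->|Z'Zs].
  rewrite -[in RHS]spanE'; congr <<_>>%VS; apply/all_filterP/allP => e eE.
  by rewrite -spanE' memv_span.
rewrite filter_cat (_ : [seq e <- E' | _] = [::]) ?EZ //.
apply/eqP; rewrite -(negbK (_ == _)) -has_filter; apply/hasP => -[e eE' eZ'].
have /negP[] := E'E e eE'; rewrite spanE.
have sZ' : (Z' <= last 0%VS Zs)%VS.
  case/splitPr: Z'Zs sZs => Zs1 Zs2 /cat_sorted2[_].
  rewrite last_cat /= path_sortedE // => /andP[/allP minZ _].
  by have := mem_last Z' Zs2; rewrite inE => /predU1P[->|/minZ].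
exact: (subvP sZ').
Qed.

End AdaptedBasis.

Section Decomposition.
Variables (R : realType) (M : pmod R) (J : eqType).
Variables (b : J -> bar R) (a : J -> forall r, {linear M r -> ('F_2)^o}).

Let target (js : seq J) : pmod R := pm_sum [seq pm_interval x | x <- [seq b j | j <- js]].

(** The row for [j] has length 0 or 1, so the functional [a j] is recorded only while its bar is
    alive. *)
Fixpoint pm_coord_fun (js : seq J) r : M r -> target js r :=
  match js return M r -> target js r with
  | [::] => fun _ => 0
  | j :: js' => fun x => (const_mx (a j r x), pm_coord_fun js' x)
  end.

Lemma pm_coord_linear js r : linear (@pm_coord_fun js r).
Proof.
elim: js => [|j js IH] c x y /=; first by rewrite scaler0 addr0.
rewrite IH; congr pair.
by apply/matrixP => i k; rewrite !mxE linearP.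
Qed.

HB.instance Definition _ js r :=
  GRing.isLinear.Build 'F_2 (M r) (target js r) _ (@pm_coord_fun js r)
    (pm_coord_linear js (r := r)).

Hypothesis a_nat : forall j r s (h : r <= s) x, in_bar (b j) s ->
  a j s (pm_map M h x) = if in_bar (b j) r then a j r x else 0.

Lemma pm_coord_nat js r s (h : r <= s) x :
  pm_coord_fun js (pm_map M h x) = pm_map (target js) h (pm_coord_fun js x).
Proof.
elim: js => //= j js ->; congr pair; rewrite /=.
move: (a_nat (j := j) h x).
case: (in_bar (b j) r) (in_bar (b j) s) => -[] => [->|_|->|_] //;
  try by rewrite [LHS]thinmx0 [RHS]thinmx0.
- by rewrite pid_mx_1 mulmx1.
- rewrite (thinmx0 (const_mx _ : 'rV_(nat_of_bool false))) mul0mx.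
  by apply/matrixP => i k; rewrite !mxE.
Qed.

Lemma pm_coord_eq0 js r x : pm_coord_fun js x = 0 :> target js r ->
  {in js, forall j, in_bar (b j) r -> a j r x = 0}.
Proof.
elim: js => //= j js IH [e0 /IH e1] j'; rewrite inE => /predU1P[-> {j'}|]; last exact: e1.
move: e0; case: (in_bar (b j) r) => // /matrixP/(_ 0 0).
by rewrite !mxE.
Qed.

Lemma pm_coord_eq js r (y : target js r) : uniq js -> exists c : J -> 'F_2,
  forall x, {in js, forall j, in_bar (b j) r -> a j r x = c j} ->
  pm_coord_fun js x = y.
Proof.
elim: js y => [|j js IH] y /=.
  by exists (fun=> 0) => x _; rewrite [LHS]thinmx0 [RHS]thinmx0.
case/andP=> jjs /(IH y.2)[c cE].
have [c0 c0E] : exists c0 : 'F_2, in_bar (b j) r ->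
    y.1 = const_mx c0 :> 'rV_(in_bar (b j) r).
  move: (y.1 : 'rV['F_2]_(in_bar (b j) r)); case: (in_bar (b j) r) => y1; last by exists 0.
  exists (y1 0 0) => _; apply/matrixP => i k.
  by rewrite !mxE (ord1 i) (ord1 k).
exists (fun j' => if j' == j then c0 else c j') => x xE.
rewrite cE => [|j' j'js ij'].
  rewrite [RHS]surjective_pairing; congr pair.
  have key (i : bool) (y1 : 'rV['F_2]_i) t : (i -> y1 = const_mx c0) ->
      (i -> t = c0) -> const_mx t = y1.
    by case: i y1 => y1 => [-> // -> //|_ _]; rewrite [LHS]thinmx0 [RHS]thinmx0.
  by apply: key c0E _ => /(xE j (mem_head _ _)); rewrite eqxx.
rewrite xE // ?inE ?j'js ?orbT //; case: eqP => // jj'.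
by rewrite -jj' j'js in jjs.
Qed.

Lemma pm_decomposition js : uniq js ->
  (forall r x, {in js, forall j, in_bar (b j) r -> a j r x = 0} -> x = 0) ->
  (forall r (c : J -> 'F_2), exists x,
     {in js, forall j, in_bar (b j) r -> a j r x = c j}) ->
  pm_iso M (target js).
Proof.
move=> ujs inj surj; exists (fun r => @pm_coord_fun js r : {linear _ -> _}).
split=> [r|r s h x]; last exact: pm_coord_nat.
have g y : {x | pm_coord_fun js x = y :> target js r}.
  apply/cid; have [c cE] := pm_coord_eq y ujs.
  by have [x xc] := surj r c; exists x; apply: cE.
exists (fun y => sval (g y)) => [x|y] /=; last by case: (g y).
case: (g _) => x' /= /eqP; rewrite -subr_eq0 -linearB => /eqP/pm_coord_eq0/inj/eqP.
by rewrite subr_eq0 => /eqP.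
Qed.

End Decomposition.

(** An up-set that is entered only at values from a finite list is either empty (threshold +oo) or
    has a least element; this is why bars are closed on the left. *)
Lemma up_set_threshold (R : realType) (vals : seq R) (P : pred R) :
  {homo P : r s / r <= s >-> r -> s} ->
  (forall r, P r -> exists v, [/\ v \in vals, v <= r & P v]) ->
  exists e : \bar R, e != -oo%E /\ forall r, P r = (e <= r%:E)%E.
Proof.
move=> monP jumpP; pose s := sort <=%O (filter P vals).
have mem_s v : (v \in s) = P v && (v \in vals) by rewrite mem_sort mem_filter.
have ss : sorted <=%O s := sort_le_sorted _.
case: s mem_s ss => [|v0 s] mem_s ss.
  exists +oo%E; split=> // r; apply/negP; rewrite leye_eq /=.
  by case/jumpP=> v [vv _ Pv]; have := mem_s v; rewrite Pv vv.
exists v0%:E; split=> // r; rewrite lee_fin; apply/idP/idP.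
  case/jumpP=> v [vv vr Pv]; apply: le_trans vr.
  have := mem_s v; rewrite Pv vv inE => /predU1P[->//|vs].
  by move: ss; rewrite /= (path_sortedE le_trans) => /andP[/allP/(_ v vs)].
move=> v0r; apply: monP v0r _.
by have := mem_s v0; rewrite mem_head => /esym/andP[].
Qed.

Lemma coord_span_filter (K : fieldType) (V : vectType K) (E : seq V) (P : pred V)
    (i : 'I_(size E)) (x : V) :
  free E -> x \in <<[seq e <- E | P e]>>%VS -> ~~ P E`_i ->
  coord (in_tuple E) i x = 0.
Proof.
move=> freeE xP nPi; pose g : {linear V -> K^o} := coord (in_tuple E) i.
suff /subvP/(_ x xP) : (<<[seq e <- E | P e]>> <= lker (linfun g))%VS.
  by rewrite memv_ker lfunE => /eqP.
apply/span_subvP => e; rewrite mem_filter memv_ker lfunE => /andP[Pe eE] /=.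
have eEi := eE; rewrite -index_mem in eEi.
have eE' : (in_tuple E)`_(Ordinal eEi) = e by exact: nth_index.
rewrite -{1}eE' coord_free //; have [iE|//] := eqVneq i (Ordinal eEi).
by move: nPi; rewrite iE -/(tval (in_tuple E)) eE' Pe.
Qed.

Section HomologyDecomposition.
Local Open Scope quotient_scope.
Variables (R : realType) (d : nat) (m : 'I_d -> nat) (f : cube m -> R) (k : int).
Local Notation Z := (cycles f k).
Local Notation B := (boundaries f k).
Hypothesis BZ : forall r, (B r <= Z r)%VS.

Let vals := codom f.

(** Lowering r to the largest value of [f] below it does not change the sub-level; if there is no
    such value, the sub-level is empty. *)
Lemma sublevel_jump r : (Z r = 0)%VS \/ (exists v, [/\ v \in vals, v <= r, Z v = Z r & B v = B r]).
Proof.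
have [[s0 fs0]|nr] := pselect (exists s, f s <= r).
  have [s fs maxs] := @arg_maxP _ _ _ s0 (fun s => f s <= r) f fs0.
  have cE j : sublevel_cells f j (f s) = sublevel_cells f j r.
    apply/finset.setP => t; rewrite !inE; congr andb.
    by apply/idP/idP => [/le_trans|]; [apply|exact: maxs].
  right; exists (f s); split; [exact: codom_f|exact: fs| |];
    by rewrite /cycles /boundaries /sublevel_chains cE.
left; apply/eqP; rewrite -subv0; apply: subv_trans (capvSr _ _) _.
apply/span_subvP => c /mapP[s]; rewrite mem_enum inE => /andP[_ fsr].
by case: nr; exists s.
Qed.

(** Each vector of a basis adapted to all [Z r] and all [B r] carries one bar, from its entrance
    into [Z] to its entrance into [B]; vectors entering both at once give empty bars and are
    dropped. The clause on vanishing cycles later confines the diagram to finitely many degrees. *)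
Lemma homology_decomposition : exists D : seq (bar R),
  [/\ {in D, forall x, (x.1%:E < x.2)%E}, (forall r, Z r = 0%VS) -> D = [::] &
      pm_iso (sublevel_homology f k) (pm_sum [seq pm_interval x | x <- D])].
Proof.
have totB : {in [seq B v | v <- vals] &, forall U U', (U <= U')%VS || (U' <= U)%VS}.
  move=> _ _ /mapP[v _ ->] /mapP[w _ ->].
  by case: (leP v w) => [|/ltW] vw; rewrite (boundariesS f k vw) ?orbT.
have sZ : sorted (fun U U' => (U <= U')%VS) [seq Z v | v <- sort <=%O vals].
  by apply: (homo_sorted _ _ (sort_le_sorted vals)) => v w; apply: cyclesS.
have [E [freeE spanE EZ' EB']] := adapted_basis totB sZ.
have EZ r : <<[seq e <- E | e \in Z r]>>%VS = Z r.
  have [Z0|[v [vv _ Zv _]]] := sublevel_jump r.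
    apply/eqP; rewrite eqEsubv [in X in _ && X]Z0 sub0v andbT.
    by apply/span_subvP => e; rewrite mem_filter => /andP[].
  by rewrite -Zv EZ' // map_f // mem_sort.
have ZE r : (Z r <= <<E>>)%VS.
  by rewrite -EZ; apply: sub_span => e; rewrite mem_filter => /andP[].
have EB r x : x \in B r -> x \in <<[seq e <- E | e \in B r]>>%VS.
  move=> xB; have xZ := subvP (BZ r) x xB.
  have [Z0|[v [vv _ _ Bv]]] := sublevel_jump r.
    by move: xZ; rewrite Z0 memv0 => /eqP ->; rewrite mem0v.
  rewrite -Bv; apply: EB'; first exact: map_f.
    exact: subvP (ZE r) x xZ.
  by rewrite Bv.
have E0 (i : 'I_(size E)) : E`_i != 0.
  by apply: contraTneq freeE => i0; apply/negP => /free_not0/(_ (mem_nth 0 (ltn_ord i)))/eqP.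
have thr (i : 'I_(size E)) : {I : bar R | forall r,
    ((E`_i \in Z r) = (I.1 <= r)) /\ ((E`_i \in B r) = (I.2 <= r%:E)%E)}.
  apply/cid.
  have EiE : E`_i \in <<E>>%VS by rewrite memv_span ?mem_nth.
  have [r1 Er1] : exists r, E`_i \in Z r.
    move: EiE; rewrite spanE => /[dup] iE.
    have := mem_last 0%VS [seq Z v | v <- sort <=%O vals].
    rewrite inE => /predU1P[-> |/mapP[v _ ->]]; last by exists v.
    by rewrite memv0 (negbTE (E0 i)).
  have jumpZ r : E`_i \in Z r -> exists v, [/\ v \in vals, v <= r, Z v = Z r & B v = B r].
    by case: (sublevel_jump r) => // ->; rewrite memv0 (negbTE (E0 i)).
  have [b [bN bE]] : exists b : \bar R, b != -oo%E /\ forall r, (E`_i \in Z r) = (b <= r%:E)%E.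
    apply: (@up_set_threshold _ vals (fun r => E`_i \in Z r)).
      by move=> r s rs; apply/subvP/cyclesS.
    by move=> r /[dup] Er /jumpZ[v [vv vr Zv _]]; exists v; rewrite Zv.
  have [e [eN eE]] : exists e : \bar R, e != -oo%E /\ forall r, (E`_i \in B r) = (e <= r%:E)%E.
    apply: (@up_set_threshold _ vals (fun r => E`_i \in B r)).
      by move=> r s rs; apply/subvP/boundariesS.
    by move=> r /[dup] Er /(subvP (BZ r))/jumpZ[v [vv vr _ Bv]]; exists v; rewrite Bv.
  case: b bN bE => [b _ bE| _ bE|//]; last by have := bE r1; rewrite Er1 leye_eq.
  by exists (b, e) => r; rewrite bE eE.
pose I i := sval (thr i).
have inI i r : in_bar (I i) r = (E`_i \in Z r) && (E`_i \notin B r).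
  rewrite /in_bar /I; case: (thr i) => J /= /(_ r)[-> ->].
  by rewrite ltNge.
pose js := [seq i <- enum 'I_(size E) | ((I i).1%:E < (I i).2)%E].
have in_js i r : in_bar (I i) r -> i \in js.
  case/andP=> Ir rI; rewrite mem_filter mem_enum andbT.
  by apply: le_lt_trans rI; rewrite lee_fin.
pose cf (i : 'I_(size E)) : {linear chain m -> ('F_2)^o} := coord (in_tuple E) i.
have cfE (i : 'I_(size E)) P x : x \in <<[seq e <- E | P e]>>%VS -> ~~ P E`_i -> cf i x = 0.
  exact: coord_span_filter.
(* While the bar is alive, the basis vector lies outside [B r], so this coordinate vanishes on
   boundaries and is independent of the representative; at other levels it is set to 0. *)
pose a i r (x : homology f k r) : ('F_2)^o := if in_bar (I i) r then cf i (vsval (repr x)) else 0.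
have a_pi i r (z : subvs_of (Z r)) :
    a i r (\pi_(quotv (bounding f k r)) z) = if in_bar (I i) r then cf i (vsval z) else 0.
  rewrite /a inI; case: ifP => // /andP[_ iB]; apply/eqP; rewrite -subr_eq0 -linearB.
  apply/eqP/cfE/iB/EB.
  by have := quotv_repr (bounding f k r) z; rewrite mem_bounding.
have aL i r : linear (a i r).
  move=> c x y; elim/quotW: x => x; elim/quotW: y => y.
  rewrite -quotv_pi_linear !a_pi; case: ifP => _; last by rewrite scaler0 addr0.
  by have -> : vsval (c *: x + y) = c *: vsval x + vsval y by []; rewrite linearP.
pose al i r : {linear sublevel_homology f k r -> ('F_2)^o} :=
  HB.pack (a i r) (GRing.isLinear.Build _ _ _ _ (a i r) (aL i r)).
exists [seq I i | i <- js]; split.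
- by move=> _ /mapP[i + ->]; rewrite mem_filter => /andP[].
- move=> Z0; case: js {in_js} => // i js'.
  have := free_not0; move: spanE.
  have -> : last 0%VS [seq Z v | v <- sort <=%O vals] = 0%VS.
    have := mem_last 0%VS [seq Z v | v <- sort <=%O vals].
    by rewrite inE => /predU1P[//|/mapP[v _ ->]].
  move=> E00 _; case/negP: (E0 i).
  by rewrite -memv0 -E00 memv_span // mem_nth.
- apply: (@pm_decomposition _ (sublevel_homology f k) _ I al).
  + move=> i r s h x; elim/quotW: x => z; rewrite /= /homology_map /= quotv_mapE !a_pi.
    rewrite cycle_inclE // !inI => /[dup] /andP[_ iBs] ->.
    have iBr : E`_i \notin B r by apply: contra iBs; apply/subvP/boundariesS.
    rewrite iBr andbT; case iZr: (E`_i \in Z r) => //.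
    by apply: (cfE i (fun e => e \in Z r)); rewrite ?EZ ?subvsP ?iZr.
  + by rewrite filter_uniq // enum_uniq.
  + move=> r x; elim/quotW: x => z az.
    have <- : \pi_(quotv (bounding f k r)) 0 = 0 := raddf0 _.
    apply/quotv_eqP; rewrite subr0 mem_bounding.
    have zE : vsval z \in <<in_tuple E>>%VS by apply: subvP (ZE r) _ (subvsP z).
    rewrite (coord_span zE); apply: memv_suml => i _.
    have [->|ci0] := eqVneq (coord (in_tuple E) i (vsval z)) 0; first by rewrite scale0r mem0v.
    have iZ : E`_i \in Z r.
      apply: contraNT ci0 => iZ; apply/eqP/(cfE i (fun e => e \in Z r)) => //.
      by rewrite EZ subvsP.
    rewrite memvZ //; apply: contraNT ci0 => iB.
    have ib : in_bar (I i) r by rewrite inI iZ.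
    by have := az i (in_js _ _ ib) ib; rewrite /= a_pi ib => /eqP.
  + move=> r c; pose y : chain m := \sum_i (if in_bar (I i) r then c i else 0) *: (in_tuple E)`_i.
    have yZ : y \in Z r.
      apply: memv_suml => i _; rewrite inI; case: ifP => [/andP[iZ _]|_]; first by rewrite memvZ.
      by rewrite scale0r mem0v.
    exists (\pi_(quotv (bounding f k r)) (vsproj (Z r) y)) => i _ ib.
    by rewrite /= a_pi ib vsprojK // /cf /= coord_sum_free // ib.
Qed.

End HomologyDecomposition.

(** * Adjoint maps between spaces of chains *)

Section Adjoint.
Variable K : fieldType.

Definition dot (T : finType) (x y : {ffun T -> K^o}) : K := \sum_t x t * y t.

Section Dot.
Variable T : finType.
Implicit Types x y : {ffun T -> K^o}.

Lemma dotC x y : dot x y = dot y x.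
Proof. by apply: eq_bigr => t _; rewrite mulrC. Qed.

Lemma dot_linear x : linear (dot x : {ffun T -> K^o} -> K^o).
Proof.
move=> a y z; rewrite /dot scaler_sumr -big_split; apply: eq_bigr => t _.
by rewrite !ffunE mulrDr mulrCA.
Qed.

HB.instance Definition _ x := GRing.isLinear.Build K {ffun T -> K^o} K^o _
  (dot x : _ -> K^o) (dot_linear x).

Lemma dot0 x : dot x 0 = 0.
Proof. by rewrite (linear0 (dot x : {linear _ -> K^o})). Qed.

Lemma dot_delta x t : dot x [ffun u => (u == t)%:R] = x t.
Proof.
rewrite /dot (bigD1 t) //= ffunE eqxx mulr1 big1 ?addr0 // => u /negbTE ut.
by rewrite ffunE ut mulr0.
Qed.

Lemma dot_eq0 x : (forall y, dot x y = 0) -> x = 0.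
Proof. by move=> x0; apply/ffunP => t; rewrite -dot_delta x0 ffunE. Qed.

End Dot.

Definition adjoint (S T : finType) (f : {ffun S -> K^o} -> {ffun T -> K^o})
    (g : {ffun T -> K^o} -> {ffun S -> K^o}) :=
  forall x y, dot (f x) y = dot x (g y).

Lemma adjoint_sym (S T : finType) (f : {ffun S -> K^o} -> {ffun T -> K^o}) g :
  adjoint f g -> adjoint g f.
Proof. by move=> fg y x; rewrite dotC -fg dotC. Qed.

(** Pairing y with a basis of the image of [f] has at most dim (limg f) coordinates, and if they all
    vanish then g y = 0. This is the equality of row rank and column rank, free of matrices. *)
Lemma adjoint_dim_leq (S T : finType) (f : 'Hom({ffun S -> K^o}, {ffun T -> K^o}))
    (g : 'Hom({ffun T -> K^o}, {ffun S -> K^o})) :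
  adjoint f g -> (\dim (limg g) <= \dim (limg f))%N.
Proof.
move=> fg; pose U := limg f; pose n := \dim U.
pose h (y : {ffun T -> K^o}) : {ffun 'I_n -> K^o} := [ffun i : 'I_n => dot (vbasis U)`_i y].
have hL : linear h by move=> a x y; apply/ffunP => i;
    rewrite !ffunE (linearP (dot _ : {linear _ -> K^o})).
pose hl : {linear {ffun T -> K^o} -> {ffun 'I_n -> K^o}} :=
  HB.pack h (GRing.isLinear.Build _ _ _ _ h hL).
have kerhg : (lker (linfun hl) <= lker g)%VS.
  apply/subvP => y; rewrite !memv_ker lfunE /= => /eqP hy0.
  apply/eqP/dot_eq0 => x; rewrite dotC -fg.
  have fxU : f x \in U by rewrite memv_img ?memvf.
  rewrite (coord_vbasis fxU) dotC.
  rewrite (linear_sum (dot y : {linear _ -> K^o})) big1 //= => i _.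
  rewrite (linearZ_LR (dot y : {linear _ -> K^o})) /= dotC.
  by have /ffunP/(_ i) := hy0; rewrite !ffunE => ->; rewrite scaler0.
have := limg_ker_dim g fullv; have := limg_ker_dim (linfun hl) fullv.
rewrite !capfv => e1 e2.
have le1 : (\dim (limg (linfun hl)) <= n)%N.
  have := dimvS (subvf (limg (linfun hl))).
  by rewrite !dimvf /dim /= card_ord muln1.
have := dimvS kerhg; rewrite -(leq_add2r (\dim (limg g))) e2 -e1 leq_add2l.
by move/leq_trans; apply.
Qed.

Lemma adjoint_dim (S T : finType) (f : 'Hom({ffun S -> K^o}, {ffun T -> K^o}))
    (g : 'Hom({ffun T -> K^o}, {ffun S -> K^o})) :
  adjoint f g -> \dim (limg f) = \dim (limg g).
Proof.
by move=> fg; apply/eqP; rewrite eqn_leq !adjoint_dim_leq //; apply: adjoint_sym.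
Qed.

Lemma adjoint_exists (T : finType) (f : 'End({ffun T -> K^o})) :
  exists g : 'End({ffun T -> K^o}), adjoint f g.
Proof.
pose g (y : {ffun T -> K^o}) : {ffun T -> K^o} :=
  [ffun t => dot (f [ffun u => (u == t)%:R]) y].
have gL : linear g by move=> a x y; apply/ffunP => i;
    rewrite !ffunE (linearP (dot _ : {linear _ -> K^o})).
pose gl : {linear {ffun T -> K^o} -> {ffun T -> K^o}} :=
  HB.pack g (GRing.isLinear.Build _ _ _ _ g gL).
exists (linfun gl) => x y; rewrite lfunE /=.
have {1}-> : x = \sum_t x t *: ([ffun u => (u == t)%:R] : {ffun T -> K^o}).
  apply/ffunP => t; rewrite sum_ffunE (bigD1 t) //= !ffunE eqxx [_ *: _]mulr1.
  by rewrite big1 ?addr0 // => u /negbTE ut; rewrite !ffunE eq_sym ut [_ *: _]mulr0.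
rewrite linear_sum dotC (linear_sum (dot y : {linear _ -> K^o})).
apply: eq_bigr => t _; rewrite linearZ (linearZ_LR (dot y : {linear _ -> K^o})) /=.
by rewrite ffunE dotC.
Qed.

(* For a subspace [U], the kernel of an adjoint of [projv U] is the orthogonal of
   [U]; so [dim U] is determined by the orthogonal of [U]. *)
Lemma memv_limg_adjoint (S T : finType) (f : 'Hom({ffun S -> K^o}, {ffun T -> K^o}))
    (g : 'Hom({ffun T -> K^o}, {ffun S -> K^o})) x :
  adjoint f g -> (forall y, g y = 0 -> dot x y = 0) -> x \in limg f.
Proof.
move=> fg xg; pose U := limg f; pose U' := (U + <[x]>)%VS.
have dimU (W : {vspace {ffun T -> K^o}}) (p : 'End({ffun T -> K^o})) :
    adjoint (projv W) p -> (\dim (lker p) + \dim W)%N = \dim {:{ffun T -> K^o}}.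
  move=> adp; rewrite -(limg_ker_dim p fullv) capfv -(adjoint_dim adp).
  congr (_ + \dim _)%N; apply/eqP; rewrite eqEsubv.
  apply/andP; split; apply/subvP => y; last by case/memv_imgP=> z _ ->; exact: memv_proj.
  by move=> yW; rewrite -(projv_id yW) memv_img ?memvf.
have kerp (W : {vspace {ffun T -> K^o}}) (p : 'End({ffun T -> K^o})) y :
    adjoint (projv W) p -> (y \in lker p) <-> forall z, z \in W -> dot z y = 0.
  move=> adp; rewrite memv_ker; split=> [/eqP py z zW|Wy].
    by rewrite -(projv_id zW) adp py dot0.
  by apply/eqP/dot_eq0 => z; rewrite dotC -adp Wy ?memv_proj.
have [p adp] := adjoint_exists (projv U).
have [p' adp'] := adjoint_exists (projv U').
(* A vector orthogonal to [U] is killed by [g], hence orthogonal to x as well: adding x to [U]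
   changes neither the orthogonal nor, therefore, the dimension. *)
have kpp' : lker p = lker p'.
  apply/vspaceP => y; apply/idP/idP.
    move/(kerp _ _ _ adp) => yU; apply/(kerp _ _ _ adp') => z /memv_addP[u uU [w]].
    case/vlineP=> a -> ->; rewrite dotC (linearD (dot y : {linear _ -> K^o})) /= dotC yU //.
    rewrite (linearZ_LR (dot y : {linear _ -> K^o})) /= dotC xg ?scaler0 ?addr0 //.
    by apply: dot_eq0 => z'; rewrite dotC -fg yU // memv_img ?memvf.
  move/(kerp _ _ _ adp') => yU; apply/(kerp _ _ _ adp) => z zU.
  by apply: yU; apply: subvP zU; apply: addvSl.
have := dimU _ _ adp; rewrite -(dimU _ _ adp') kpp' => /addnI/eqP dimUU'.
have /eqP UU' : U == U' by rewrite eqEdim addvSl (eqP dimUU') leqnn.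
by rewrite -/U UU' -[x]add0r memv_add ?mem0v ?memv_line.
Qed.

End Adjoint.

(** * Cohomology of a box *)

Section ElementaryIntervals.
Variable k : nat.
Implicit Types e t s : elem_itv k.

Definition is_edge e : bool := if e is inr _ then true else false.

Definition vlo (l : 'I_k.-1) : 'I_k := widen_ord (leq_pred k) l.

Fact vhi_subproof (l : 'I_k.-1) : (l.+1 < k)%N.
Proof. by case: k l => [|k'] [l]. Qed.
Definition vhi (l : 'I_k.-1) : 'I_k := Ordinal (vhi_subproof l).

Definition sub_itv t s := (itv_lo s <= itv_lo t)%N && (itv_hi t <= itv_hi s)%N.

Lemma itv_neqE e : (itv_lo e != itv_hi e) = is_edge e.
Proof. by case: e => l /=; rewrite ?eqxx // ltn_eqF. Qed.

Lemma sub_itv_refl e : sub_itv e e.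
Proof. by rewrite /sub_itv !leqnn. Qed.

Lemma sub_itv_eq t s : sub_itv t s -> is_edge t = is_edge s -> t = s.
Proof.
case: t s => t [] s //= /andP[/= le1 le2] _; congr (_ _); apply: val_inj => /=;
  by apply/eqP; rewrite eqn_leq le1 ?andbT.
Qed.

Lemma sub_itv_edge t s : sub_itv t s -> is_edge t -> is_edge s.
Proof.
case: t s => [//|t] [] s //= /andP[/= le1 le2] _.
by have := leq_trans le2 le1; rewrite ltnn.
Qed.

Lemma sub_itv_facet (v : 'I_k) (l : 'I_k.-1) :
  sub_itv (inl v) (inr l) = (v == vlo l) || (v == vhi l).
Proof.
rewrite /sub_itv -!val_eqE /=; apply/andP/orP => [[lv]|[]/eqP->];
  rewrite ?leqnn ?leqnSn //.
by rewrite leq_eqVlt ltnS => /orP[->|vl]; [right|left; rewrite eqn_leq vl lv].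
Qed.

End ElementaryIntervals.

Section CubeComplex.
Variables (d : nat) (m : 'I_d -> nat).
Implicit Types (s t : cube m) (c : chain m) (i j : 'I_d).

Lemma faceE t s : face t s = [forall i, sub_itv (t i) (s i)].
Proof. by []. Qed.

Lemma cube_dimE s : cube_dim s = #|[set i | is_edge (s i)]|.
Proof. by apply: eq_card => i; rewrite !inE itv_neqE. Qed.

Definition upd s j (e : elem_itv (m j)) : cube m := [ffun i => dfwith (fun i => s i) e i].

Lemma upd_in s j e : @upd s j e j = e.
Proof. by rewrite ffunE dfwith_in. Qed.

Lemma upd_out s j e i : j != i -> @upd s j e i = s i.
Proof. by move=> ji; rewrite ffunE dfwith_out. Qed.

Lemma cube_eq s t j : s j = t j -> (forall i, j != i -> s i = t i) -> s = t.
Proof. by move=> ej ei; apply/ffunP => i; case: (eqVneq j i) => [<-|/ei]. Qed.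

Lemma upd_upd s j e e' : upd (@upd s j e) e' = @upd s j e'.
Proof. by apply: (@cube_eq _ _ j) => [|i ji]; rewrite ?upd_in ?upd_out. Qed.

Lemma upd_id s j : upd s (s j) = s.
Proof. by apply: (@cube_eq _ _ j) => [|i ji]; rewrite ?upd_in ?upd_out. Qed.

Lemma updC s i j e e' : i != j -> upd (@upd s i e) e' = upd (@upd s j e') e.
Proof.
move=> ij; apply/ffunP => k; have ji : j != i by rewrite eq_sym.
have [<-|ik] := eqVneq i k; first by rewrite upd_out // !upd_in.
have [<-|jk] := eqVneq j k; first by rewrite upd_in upd_out // upd_in.
by rewrite !upd_out.
Qed.

Definition facet s (p : 'I_d * bool) : cube m :=
  if s p.1 is inr l then upd s (inl (if p.2 then vhi l else vlo l)) else s.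

(** In codimension one exactly one edge direction is lost. In every other direction the nested
    intervals have the same length and so coincide. *)
Lemma dim_facet t s : face t s && (cube_dim s == (cube_dim t).+1) =
  (t \in [set facet s p | p in [set p | is_edge (s p.1)]]).
Proof.
apply/idP/imsetP.
  rewrite faceE => /andP[/forallP ts]; rewrite !cube_dimE => dim1.
  pose Es := [set i | is_edge (s i)]; pose Et := [set i | is_edge (t i)].
  have sub : Et \subset Es by apply/fintype.subsetP => i; rewrite !inE; apply: sub_itv_edge.
  have : #|Es :\: Et| == 1%N by rewrite cardsDS // (eqP dim1) subSnn.
  case/cards1P=> j Ej.
  have [] : is_edge (s j) /\ ~~ is_edge (t j).
    have : j \in Es :\: Et by rewrite Ej inE.
    by rewrite !inE => /andP[].
  have out i : j != i -> t i = s i.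
    move=> ji; apply: sub_itv_eq => //; apply/idP/idP; first exact: sub_itv_edge.
    move=> si; have : i \notin Es :\: Et by rewrite Ej inE eq_sym.
    by rewrite !inE si andbT negbK.
  case sj: (s j) => [//|l]; case tj: (t j) => [v|//] _ _.
  have := ts j; rewrite sj tj sub_itv_facet => vE.
  exists (j, v == vhi l); first by rewrite inE sj.
  rewrite /facet /= sj; apply: (@cube_eq _ _ j) => [|i ji]; last by rewrite upd_out ?out.
  by rewrite upd_in tj; case: (v =P vhi l) vE => [-> //|_]; rewrite orbF => /eqP ->.
case=> -[j b]; rewrite inE /= => sj ->; rewrite /facet /=.
case sjE: (s j) sj => [//|l] _; apply/andP; split.
  apply/forallP => i; rewrite -/(sub_itv _ _); have [<-|ji] := eqVneq j i.
    rewrite upd_in sjE sub_itv_facet; by case: b; apply/orP; [right|left].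
  by rewrite upd_out // sub_itv_refl.
rewrite !cube_dimE (cardsD1 j) inE sjE add1n eqSS; apply/eqP/eq_card => i.
rewrite !inE; have [<-|ji] := eqVneq j i; first by rewrite upd_in.
by rewrite upd_out.
Qed.

Lemma facet_inj s : {in [set p | is_edge (s p.1)] &, injective (facet s)}.
Proof.
move=> [i b] [j b']; rewrite !inE /= => si sj eij.
have ij : i = j.
  apply/eqP; apply: contraT => ij.
  move: si sj eij; rewrite /facet /=.
  case si: (s i) => [//|l] _; case sj: (s j) => [//|l'] _.
  move/(congr1 (fun u : cube m => u i)).
  by rewrite upd_in upd_out 1?eq_sym // si.
case: _ / ij sj eij => _; rewrite /facet /=; case: (s i) si => [//|l] _.
move/(congr1 (fun u : cube m => u i)); rewrite !upd_in => -[] e; congr pair.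
by case: b b' e => -[] // /(congr1 (@nat_of_ord _)) /= /eqP; rewrite eqn_leq ltnn ?andbF.
Qed.

Definition cob_fun c : chain m :=
  [ffun s => \sum_(t | face t s && (cube_dim s == (cube_dim t).+1)) c t].

Lemma cob_linear : linear cob_fun.
Proof.
move=> a x y; apply/ffunP => t; rewrite !ffunE scaler_sumr -big_split /=.
by apply: eq_bigr => s _; rewrite !ffunE.
Qed.
HB.instance Definition _ :=
  GRing.isLinear.Build 'F_2 (chain m) (chain m) _ cob_fun cob_linear.

Definition cob : 'End(chain m) := linfun cob_fun.

Lemma boundary_cob_adjoint : adjoint (boundary m) cob.
Proof.
move=> x y; rewrite /boundary /cob !lfunE /= /dot.
under eq_bigr do rewrite ffunE mulr_suml.
under [RHS]eq_bigr do rewrite ffunE mulr_sumr.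
by rewrite (exchange_big_dep predT).
Qed.

(** The coboundary in the single direction [j]: the box is a product of one-dimensional complexes,
    and the full coboundary is the sum of these partial ones. *)
Definition dcob j c : chain m :=
  [ffun s : cube m => if s j is inr l then c (upd s (inl (vlo l))) + c (upd s (inl (vhi l)))
             else 0 : ('F_2)^o].

Lemma cob_sum c s : cob c s = \sum_j dcob j c s.
Proof.
rewrite lfunE /= ffunE (eq_bigl _ _ (fun t => dim_facet t s)).
rewrite big_imset /=; last exact: facet_inj.
transitivity (\sum_(j | is_edge (s j)) \sum_(b : bool) c (facet s (j, b))).
  by rewrite pair_big_dep; apply: eq_big => -[j b]; rewrite ?inE ?andbT.
rewrite big_mkcond; apply: eq_bigr => j _; rewrite ffunE /facet /=.
by case: (s j) => //= l; rewrite big_bool /= addrC.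
Qed.

End CubeComplex.

Lemma addFF (x : 'F_2) : x + x = 0.
Proof. by apply/addrr_pchar2/pchar_Fp. Qed.

Lemma addFF_eq0 (x y : 'F_2) : (x + y == 0) = (x == y).
Proof. by rewrite -(subr_eq0 x y); congr (_ + _ == 0); rewrite -[RHS]add0r -(addFF y) addrK. Qed.

Lemma sum_symmetric_eq0 n (a : 'I_n -> 'I_n -> 'F_2) :
  (forall i, a i i = 0) -> (forall i j, i != j -> a i j = a j i) ->
  \sum_i \sum_j a i j = 0.
Proof.
move=> aii aij; pose S := \sum_(i < n) \sum_(j < n | (j < i)%N) a i j.
have -> : \sum_i \sum_j a i j = S + \sum_(i < n) \sum_(j < n | (i < j)%N) a i j.
  rewrite -big_split; apply: eq_bigr => i _ /=.
  rewrite (bigID (fun j : 'I_n => (j < i)%N)) /=; congr (_ + _).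
  rewrite (bigD1 i) ?ltnn //= aii add0r; apply: eq_bigl => j.
  by rewrite -leqNgt ltn_neqAle andbC eq_sym.
rewrite (exchange_big_dep predT) //= -[RHS](addFF S); congr (_ + _).
by apply: eq_bigr => i _; apply: eq_bigr => j ji; rewrite aij // -val_eqE ltn_eqF.
Qed.

Section Cohomology.
Variables (d : nat) (m : 'I_d -> nat).
Implicit Types (s t : cube m) (c : chain m) (i j : 'I_d).

Lemma dcob_edge j c s l : s j = inr l ->
  dcob j c s = c (upd s (inl (vlo l))) + c (upd s (inl (vhi l))).
Proof. by rewrite ffunE => ->. Qed.

Lemma dcob_vertex j c s v : s j = inl v -> dcob j c s = 0.
Proof. by rewrite ffunE => ->. Qed.

Lemma dcob_dcob j c s : dcob j (dcob j c) s = 0.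
Proof.
case sj: (s j) => [v|l]; first exact: dcob_vertex sj.
by rewrite (dcob_edge _ sj) !(@dcob_vertex j c (upd _ _) _ (upd_in _ _)) addr0.
Qed.

Lemma dcobC i j c s : i != j -> dcob i (dcob j c) s = dcob j (dcob i c) s.
Proof.
move=> ij; have ji : j != i by rewrite eq_sym.
case si: (s i) => [v|l]; case sj: (s j) => [w|k].
- by rewrite (dcob_vertex _ si) (dcob_vertex _ sj).
- rewrite (dcob_vertex _ si) (dcob_edge _ sj).
  by rewrite !(@dcob_vertex i c (upd _ _) v) ?addr0 ?upd_out.
- rewrite (dcob_vertex _ sj) (dcob_edge _ si).
  by rewrite !(@dcob_vertex j c (upd _ _) w) ?addr0 ?upd_out.
rewrite (dcob_edge _ si) (dcob_edge _ sj).
rewrite !(@dcob_edge j c (upd _ _) k) ?upd_out //.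
rewrite !(@dcob_edge i c (upd _ _) l) ?upd_out //.
by rewrite !(fun e e' => @updC _ _ s j i e e' ji) addrACA.
Qed.

(** Partial coboundaries square to zero and commute, so the double sum is symmetric with zero
    diagonal and cancels in pairs over F_2. *)
Lemma cob_cob c : cob m (cob m c) = 0.
Proof.
apply/ffunP => s; rewrite cob_sum [RHS]ffunE.
have -> : \sum_i dcob i (cob m c) s = \sum_i \sum_j dcob i (dcob j c) s.
  apply: eq_bigr => i _; case si: (s i) => [v|l].
    by rewrite (dcob_vertex _ si) big1 // => j _; rewrite (dcob_vertex _ si).
  rewrite (dcob_edge _ si) !cob_sum -big_split; apply: eq_bigr => j _.
  by rewrite (dcob_edge _ si).
by apply: sum_symmetric_eq0 => [i|i j ij]; [exact: dcob_dcob|exact: dcobC].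
Qed.

Hypothesis mpos : forall j, (0 < m j)%N.

Definition vbase j : elem_itv (m j) := inl (Ordinal (mpos j)).

(* Summing a cocycle along the direction [j], starting from [vbase j], is a homotopy
   from the identity to [restr j]. *)
Definition primitive j c : chain m :=
  [ffun s : cube m => if s j is inl v then \sum_(l < (m j).-1 | (l < v)%N) c (upd s (inr l))
             else 0 : ('F_2)^o].

Definition restr j c : chain m :=
  [ffun s : cube m => if s j is inl v then c (upd s (vbase j)) else 0 : ('F_2)^o].

Lemma primitive_edge j c s l : s j = inr l -> primitive j c s = 0.
Proof. by rewrite ffunE => ->. Qed.

Lemma primitive_vertex j c s v : s j = inl v ->
  primitive j c s = \sum_(l < (m j).-1 | (l < v)%N) c (upd s (inr l)).
Proof. by rewrite ffunE => ->. Qed.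

(** A discrete fundamental theorem of calculus along [j]. On an edge, the partial sums at its two
    ends differ by one term; on a vertex, the increments telescope down to the base. *)
Lemma dcob_primitive j c s :
  dcob j (primitive j c) s + primitive j (dcob j c) s = c s + restr j c s.
Proof.
case sj: (s j) => [v|l]; last first.
  rewrite (primitive_edge _ sj) (dcob_edge _ sj) addr0 [restr _ _ _]ffunE sj addr0.
  rewrite !(@primitive_vertex j c (upd _ _) _ (upd_in _ _)).
  rewrite [X in _ + X](bigD1 l) ?ltnSn //= addrCA upd_upd -sj upd_id.
  rewrite -[RHS]addr0; congr (_ + _); apply/eqP; rewrite addFF_eq0; apply/eqP.
  apply: eq_big => [k|k _]; last by rewrite !upd_upd.
  by rewrite ltnS -val_eqE ltn_neqAle andbC.
rewrite (dcob_vertex _ sj) add0r (primitive_vertex _ sj) [restr _ _ _]ffunE sj.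
(* Values along direction [j], extended by 0 to all naturals, so that the telescoping can be done by
   induction on the position. *)
pose g (n : nat) := if (insub n : option ('I_(m j))) is Some w then c (upd s (inl w)) else 0.
have gE (w : 'I_(m j)) : c (upd s (inl w)) = g w by rewrite /g valK.
under eq_bigr => l _ do
  rewrite (@dcob_edge j c (upd s (inr l)) l (upd_in _ _)) !upd_upd !gE /=.
have vm : (v <= (m j).-1)%N by rewrite -ltnS prednK.
rewrite -(big_ord_widen _ (fun n => g n + g n.+1) vm) gE /=.
have {1}-> : s = upd s (inl v) by rewrite -sj upd_id.
rewrite gE; elim: (v : nat) => [|n IH]; first by rewrite big_ord0 addFF.
by rewrite big_ord_recr /= IH addrC addrACA addFF add0r addrC.
Qed.

Lemma dcob_primitiveC i j c s : i != j -> dcob i (primitive j c) s = primitive j (dcob i c) s.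
Proof.
move=> ij; have ji : j != i by rewrite eq_sym.
case sj: (s j) => [v|l].
  rewrite (primitive_vertex _ sj); case si: (s i) => [w|k].
    rewrite (dcob_vertex _ si) big1 // => l _.
    by rewrite (@dcob_vertex i c _ w) // upd_out.
  rewrite (dcob_edge _ si) !(@primitive_vertex j c _ v) ?upd_out //.
  rewrite -big_split; apply: eq_bigr => l _ /=.
  rewrite (@dcob_edge i c _ k) ?upd_out //.
  by rewrite !(fun e e' => @updC _ _ s i j e e' ij).
rewrite (primitive_edge _ sj); case si: (s i) => [w|k]; first exact: dcob_vertex si.
by rewrite (dcob_edge _ si) !(@primitive_edge j c _ l) ?addr0 // upd_out.
Qed.

Lemma primitive_sum (I : finType) j (F : I -> chain m) s :
  primitive j (\sum_i F i) s = \sum_i primitive j (F i) s.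
Proof.
case sj: (s j) => [v|l]; last first.
  by rewrite (primitive_edge _ sj) big1 // => i _; rewrite (primitive_edge _ sj).
rewrite (primitive_vertex _ sj); under eq_bigr do rewrite sum_ffunE.
by rewrite exchange_big; apply: eq_bigr => i _; rewrite (primitive_vertex _ sj).
Qed.

(** The directions other than [j] commute with [primitive j], so their contributions occur twice and
    cancel. *)
Lemma cob_primitive j c : cob m (primitive j c) + primitive j (cob m c) = c + restr j c.
Proof.
apply/ffunP => s; rewrite [LHS]ffunE [RHS]ffunE -dcob_primitive.
have -> : cob m c = \sum_i dcob i c.
  by apply/ffunP => t; rewrite cob_sum sum_ffunE.
rewrite primitive_sum cob_sum (bigD1 j) //= [X in _ + X](bigD1 j) //= addrACA.
rewrite -[RHS]addr0; congr (_ + _); apply/eqP; rewrite addFF_eq0; apply/eqP.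
by apply: eq_bigr => i ij; rewrite dcob_primitiveC.
Qed.

Lemma addxx_chain c : c + c = 0.
Proof. by apply/ffunP => s; rewrite !ffunE addFF. Qed.

Lemma cocycle_restr j c : cob m c = 0 ->
  cob m (restr j c) = 0 /\ c = restr j c + cob m (primitive j c).
Proof.
move=> c0; have := cob_primitive j c; rewrite c0.
have -> : primitive j 0 = 0.
  by apply/ffunP => s; rewrite !ffunE; case: (s j) => // v; rewrite big1 // => l _; rewrite ffunE.
rewrite addr0 => e; split; last by rewrite e addrCA addxx_chain addr0.
have -> : restr j c = c + cob m (primitive j c) by rewrite e addrA addxx_chain add0r.
by rewrite linearD /= c0 cob_cob addr0.
Qed.

(** Restricting in every direction in turn collapses the box onto its base vertex; a cocycle changes
    by a coboundary at each stage, and only a constant on the vertices is left. *)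
Lemma cocycle_exact c : cob m c = 0 -> exists b, forall s,
  c s = (if cube_dim s == 0%N then c [ffun j => vbase j] else 0) + cob m b s.
Proof.
pose base (js : seq 'I_d) s : cube m := [ffun j => if j \in js then vbase j else s j].
(* The composite of the restrictions in the directions [js], in closed form. *)
pose rs js c : chain m :=
  [ffun s : cube m => if has (fun j => is_edge (s j)) js then 0 else c (base js s) : ('F_2)^o].
have rs_cons j js c' : rs js (restr j c') = rs (j :: js) c'.
  apply/ffunP => s; rewrite /rs !ffunE /=.
  case: (boolP (has _ js)) => hjs; first by rewrite orbT.
  rewrite orbF; case: (boolP (j \in js)) => jjs.
    rewrite /= ifN; last by apply: contra hjs => sj; apply/hasP; exists j.
    congr (c' _); apply: (@cube_eq _ _ _ _ j) => [|i ji].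
      by rewrite upd_in ffunE mem_head.
    by rewrite upd_out // !ffunE inE eq_sym (negbTE ji).
  case: (s j) => //= _; congr (c' _); apply: (@cube_eq _ _ _ _ j) => [|i ji].
    by rewrite upd_in ffunE mem_head.
  by rewrite upd_out // !ffunE inE eq_sym (negbTE ji).
have ex js c' : cob m c' = 0 -> exists b, c' = rs js c' + cob m b.
  elim: js c' => [|j js IH] c' c'0.
    exists 0; rewrite linear0 addr0; apply/ffunP => s; rewrite ffunE.
    by congr (c' _); apply/ffunP => j; rewrite ffunE.
  have [r0 cE] := cocycle_restr j c'0.
  have [b bE] := IH _ r0.
  exists (b + primitive j c'); rewrite linearD /= addrA -rs_cons -bE.
  exact: cE.
move=> /(ex (enum 'I_d))[b bE]; exists b => s; rewrite [in LHS]bE !ffunE.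
congr (_ + _); rewrite cube_dimE cards_eq0; case: (boolP (has _ _)) => hs.
  case/hasP: hs => j _ sj; case: eqP => // /finset.setP/(_ j).
  by rewrite !inE sj.
rewrite ifT; last first.
  apply/eqP/finset.setP => j; rewrite !inE; apply: contraNF hs => sj.
  by apply/hasP; exists j; rewrite ?mem_enum.
by congr (c _); apply/ffunP => j; rewrite !ffunE mem_enum.
Qed.

End Cohomology.

(** * Persistent homology from ranks of boundary submatrices *)

Section Chains.
Variables (d : nat) (m : 'I_d -> nat).
Implicit Types (s t : cube m) (c x : chain m) (P Q : pred (cube m)).

Definition inc t s := face t s && (cube_dim s == (cube_dim t).+1).

Lemma boundaryE c t : boundary m c t = \sum_(s | inc t s) c s.
Proof. by rewrite lfunE /= ffunE. Qed.

Lemma cobE c s : cob m c s = \sum_(t | inc t s) c t.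
Proof. by rewrite lfunE /= ffunE. Qed.

Definition proj_fun P c : chain m := [ffun s => if P s then c s else 0].

Lemma proj_linear P : linear (proj_fun P).
Proof.
by move=> a x y; apply/ffunP => s; rewrite !ffunE; case: ifP; rewrite // scaler0 addr0.
Qed.
HB.instance Definition _ P :=
  GRing.isLinear.Build 'F_2 (chain m) (chain m) _ (proj_fun P) (proj_linear P).

Definition proj P : 'End(chain m) := linfun (proj_fun P).

Lemma projE P c s : proj P c s = if P s then c s else 0.
Proof. by rewrite lfunE /= ffunE. Qed.

Lemma proj_id P c : (forall s, ~~ P s -> c s = 0) -> proj P c = c.
Proof. by move=> cP; apply/ffunP => s; rewrite projE; case: ifPn => // /cP. Qed.

Lemma proj_adjoint P : adjoint (proj P) (proj P).
Proof.
move=> x y; apply: eq_bigr => s _; rewrite !projE.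
by case: ifP; rewrite ?mul0r ?mulr0.
Qed.

Lemma proj_boundary P Q c : (forall t s, inc t s -> P s = Q t) ->
  boundary m (proj P c) = proj Q (boundary m c).
Proof.
move=> PQ; apply/ffunP => t; rewrite projE !boundaryE.
case: ifPn => Qt; [apply: eq_bigr|apply: big1] => s /PQ Ps; rewrite projE Ps ?Qt //.
by rewrite (negbTE Qt).
Qed.

Lemma boundary_boundary c : boundary m (boundary m c) = 0.
Proof. by apply: dot_eq0 => y; rewrite !boundary_cob_adjoint cob_cob dot0. Qed.

(** The rank of the submatrix of the boundary matrix with columns [P] and rows [Q]. *)
Definition rk_boundary P Q : nat := \dim (limg (proj Q \o (boundary m \o proj P))%VF).

Lemma eq_rk_boundary P Q P' Q' :
  (forall t s, inc t s -> P s && Q t = P' s && Q' t) ->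
  rk_boundary P Q = rk_boundary P' Q'.
Proof.
move=> eqPQ; congr (\dim (limg _)); apply/lfunP => c; rewrite !comp_lfunE.
apply/ffunP => t; rewrite !projE !boundaryE.
under eq_bigr do rewrite projE; under [in RHS]eq_bigr do rewrite projE.
transitivity (\sum_(s | inc t s) if P s && Q t then c s else 0).
  case: (Q t); first by apply: eq_bigr => s _; rewrite andbT.
  by rewrite big1 // => s _; rewrite andbF.
transitivity (\sum_(s | inc t s) if P' s && Q' t then c s else 0).
  by apply: eq_bigr => s /eqPQ ->.
case: (Q' t); first by apply: eq_bigr => s _; rewrite andbT.
by rewrite big1 // => s _; rewrite andbF.
Qed.

Section Exactness.
Hypothesis mpos : forall j, (0 < m j)%N.

(** To be a boundary is to be orthogonal to all cocycles. A cocycle is a coboundary, on which a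
    cycle vanishes, plus a constant on the vertices, on which the second hypothesis applies. *)
Lemma cycle_boundary c : boundary m c = 0 ->
  \sum_(s | cube_dim s == 0%N) c s = 0 -> c \in limg (boundary m).
Proof.
move=> c0 ec; apply: (@memv_limg_adjoint _ _ _ (boundary m) (cob m)) => [|y y0].
  exact: boundary_cob_adjoint.
have [b yE] := cocycle_exact mpos y0.
set v := [ffun j => vbase mpos j] in yE.
transitivity ((\sum_(s | cube_dim s == 0%N) c s) * y v + dot c (cob m b)).
  rewrite /dot mulr_suml [X in X + _]big_mkcond -big_split; apply: eq_bigr => s _ /=.
  by rewrite [in LHS]yE mulrDr; case: ifP; rewrite ?mulr0.
by rewrite ec mul0r add0r -boundary_cob_adjoint c0 dotC dot0.
Qed.

(** As d > 0, no vertex occurs in [c], so [c] is a boundary; but there is no cell of dimension d + 1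
    to bound. *)
Lemma top_cycle_eq0 c : (0 < d)%N -> (forall s, c s != 0 -> cube_dim s = d) ->
  boundary m c = 0 -> c = 0.
Proof.
move=> d0 cd c0.
have : c \in limg (boundary m).
  apply: cycle_boundary => //; apply: big1 => s /eqP s0.
  by apply: contraTeq d0 => /cd; rewrite s0 => <-.
case/memv_imgP=> e _ cE; apply/ffunP => s; rewrite [RHS]ffunE.
have [//|/cd sd] := eqVneq (c s) 0.
rewrite cE boundaryE big1 // => t /andP[_]; rewrite sd => /eqP td.
have : (cube_dim t <= d)%N by rewrite /cube_dim (leq_trans (max_card _)) ?card_ord.
by rewrite td ltnn.
Qed.

End Exactness.

(** The constant 0-cochain 1; pairing with it is the augmentation. *)
Definition vertices : chain m := [ffun s => (cube_dim s == 0%N)%:R].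

Lemma cob_vertices : cob m vertices = 0.
Proof.
apply/ffunP => s; rewrite cob_sum [RHS]ffunE big1 // => j _.
case sj: (s j) => [v|l]; first exact: dcob_vertex sj.
rewrite (dcob_edge _ sj) !ffunE.
have -> : cube_dim (upd s (inl (vhi l))) = cube_dim (upd s (inl (vlo l))).
  rewrite !cube_dimE; apply: eq_card => i; rewrite !inE.
  by have [<-|ji] := eqVneq j i; rewrite ?upd_in ?upd_out.
exact: addFF.
Qed.

Section Sublevels.
Variables (R : realType) (f : cube m -> R).

Lemma mem_sublevel_chains k r c : reflect
  (forall s, c s != 0 -> ((cube_dim s)%:Z == k) && (f s <= r))
  (c \in sublevel_chains f k r).
Proof.
apply: (iffP idP) => [+ s|cs].
  pose Q := [pred s | ~~ (((cube_dim s)%:Z == k) && (f s <= r))].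
  suff /subvP sub : (sublevel_chains f k r <= lker (proj Q))%VS.
    move=> /sub; rewrite memv_ker => /eqP/ffunP/(_ s); rewrite projE ffunE /=.
    by case: ifPn => [_ ->|]; [rewrite eqxx|rewrite negbK].
  apply/span_subvP => _ /mapP[t + ->]; rewrite mem_enum inE memv_ker => tk.
  apply/eqP/ffunP => s'; rewrite projE !ffunE; case: ifP => //= Qs'.
  by case: (s' =P t) Qs' => [->|//]; rewrite tk.
have -> : c = \sum_s c s *: cell_chain s.
  apply/ffunP => t; rewrite sum_ffunE -[LHS](dot_delta c t).
  by apply: eq_bigr => s _; rewrite !ffunE eq_sym.
apply: memv_suml => s _; have [->|/cs sk] := eqVneq (c s) 0; first by rewrite scale0r mem0v.
by apply/memvZ/memv_span/map_f; rewrite mem_enum inE.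
Qed.

Lemma limg_proj_sublevel k r :
  limg (proj (fun s => ((cube_dim s)%:Z == k) && (f s <= r))) = sublevel_chains f k r.
Proof.
apply/vspaceP => c; apply/idP/idP.
  case/memv_imgP=> x _ ->; apply/mem_sublevel_chains => s; rewrite projE.
  by case: ifP; rewrite ?eqxx.
move/mem_sublevel_chains=> cs; apply/memv_imgP; exists c; first exact: memvf.
by rewrite proj_id // => s; apply: contraNeq => /cs.
Qed.

Hypothesis f_mono : forall t s, face t s -> f t <= f s.

Lemma boundaries_supp k r c t : c \in boundaries f k r -> c t != 0 ->
  ((cube_dim t)%:Z == k) && (f t <= r).
Proof.
case/memv_imgP=> e /mem_sublevel_chains er ->; rewrite boundaryE => et.
have [s /andP[/andP[ts /eqP sd] es]] : exists s, inc t s && (e s != 0).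
  apply/existsP; apply: contraNT et; rewrite negb_exists => /forallP e0.
  by rewrite big1 // => s ts; have := e0 s; rewrite ts negbK => /eqP.
have := er s es; rewrite sd -addn1 PoszD => /andP[/eqP/addIr -> fs].
by rewrite eqxx (le_trans (f_mono ts)).
Qed.

Lemma boundaries_sub_cycles k r : (boundaries f k r <= cycles f k r)%VS.
Proof.
apply/subvP => c cB; rewrite memv_cap memv_ker.
have /memv_imgP[e _ cE] := cB; rewrite {1}cE boundary_boundary eqxx /=.
by apply/mem_sublevel_chains => t; apply: boundaries_supp cB.
Qed.

(** A boundary is automatically a cycle of degree [k], so it lies in [cycles f k r] exactly when its
    entries above level r vanish. The equation is rank-nullity for the projection onto these
    entries. *)
Lemma dim_cycles_boundaries k (r r' : R) :
  (\dim (cycles f k r :&: boundaries f k r') +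
   rk_boundary (fun t => ((cube_dim t)%:Z == (k + 1)%R) && (f t <= r')%R)
     (fun t => (r < f t)%R))%N =
  \dim (boundaries f k r').
Proof.
have -> : (cycles f k r :&: boundaries f k r' =
           boundaries f k r' :&: lker (proj (fun t => (r < f t)%R)))%VS.
  apply/vspaceP => c; rewrite !memv_cap andbC; case cB: (c \in boundaries f k r') => //=.
  have cker : c \in lker (boundary m).
    by have /memv_imgP[e _ ->] := cB; rewrite memv_ker boundary_boundary.
  apply/idP/idP => [/andP[_ /mem_sublevel_chains cr]|].
    rewrite memv_ker; apply/eqP/ffunP => t; rewrite projE ffunE.
    case: ltP => // rt; apply/eqP; apply: contraTT rt => /cr/andP[_].
    by rewrite -leNgt.
  move=> cQ; apply/andP; split; first exact: cker.
  move: cQ; rewrite memv_ker => /eqP/ffunP c0.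
  apply/mem_sublevel_chains => t ct.
  have /andP[-> _] := boundaries_supp cB ct.
  by have := c0 t; rewrite projE ffunE; case: ltP => // _ ct0; rewrite ct0 eqxx in ct.
by rewrite /rk_boundary !limg_comp limg_proj_sublevel limg_ker_dim.
Qed.

End Sublevels.
End Chains.

(** * The dual cell structure *)

Section Extrema.
Variables (R : realType) (T : finType) (P : pred T) (F : T -> R).

Lemma fmax_leP r : (exists x, P x) ->
  reflect (forall x, P x -> F x <= r) (fmax P F <= r).
Proof.
move=> exP; rewrite /fmax; case: pickP => [x0 Px0|P0]; last by exfalso; case: exP => y; rewrite P0.
by apply: (iffP (bigmax_leP _ _ _ _)) => [[_ //]|Fr]; split=> //; apply: Fr.
Qed.

Lemma fmax_ltP r : (exists x, P x) ->
  reflect (forall x, P x -> F x < r) (fmax P F < r).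
Proof.
move=> exP; rewrite /fmax; case: pickP => [x0 Px0|P0]; last by exfalso; case: exP => y; rewrite P0.
by apply: (iffP (bigmax_ltP _ _ _ _)) => [[_ //]|Fr]; split=> //; apply: Fr.
Qed.

Lemma fmin_geP r : (exists x, P x) ->
  reflect (forall x, P x -> r <= F x) (r <= fmin P F).
Proof.
move=> exP; rewrite /fmin; case: pickP => [x0 Px0|P0]; last by exfalso; case: exP => y; rewrite P0.
by apply: (iffP (bigmin_geP _ _ _ _)) => [[_ //]|Fr]; split=> //; apply: Fr.
Qed.

Lemma fmin_gtP r : (exists x, P x) ->
  reflect (forall x, P x -> r < F x) (r < fmin P F).
Proof.
move=> exP; rewrite /fmin; case: pickP => [x0 Px0|P0]; last by exfalso; case: exP => y; rewrite P0.
by apply: (iffP (bigmin_gtP _ _ _ _)) => [[_ //]|Fr]; split=> //; apply: Fr.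
Qed.

Lemma fmin_attained : (exists x, P x) -> exists2 x, P x & F x = fmin P F.
Proof.
move=> exP; apply: contrapT => nex.
have : fmin P F < fmin P F.
  apply/fmin_gtP => // x Px; rewrite lt_neqAle; apply/andP; split.
    by apply/eqP => e; apply: nex; exists x.
  exact: (elimT (fmin_geP _ exP) (lexx _)).
by rewrite ltxx.
Qed.

Lemma fmin_leP r : (exists x, P x) ->
  reflect (exists2 x, P x & F x <= r) (fmin P F <= r).
Proof.
move=> exP; apply: (iffP idP) => [le_r|[x Px]].
  by have [x Px Fx] := fmin_attained exP; exists x; rewrite ?Fx.
by apply: le_trans; apply: (elimT (fmin_geP _ exP) (lexx _)).
Qed.

End Extrema.

Lemma face_refl d (m : 'I_d -> nat) (s : cube m) : face s s.
Proof. by apply/forallP => i; rewrite !leqnn. Qed.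

Lemma face_trans d (m : 'I_d -> nat) : transitive (@face d m).
Proof.
move=> s t u /forallP ts /forallP su; apply/forallP => i.
have /andP[le1 le2] := ts i; have /andP[le3 le4] := su i.
by rewrite (leq_trans le3) // (leq_trans le2).
Qed.

Section Constructions.
Variables (R : realType) (d : nat) (n : 'I_d -> nat) (J : grid n -> R).

Lemma vertex_ex (s : cube n) : exists p, face (V_vertex p) s.
Proof.
pose lo (i : 'I_d) : 'I_(n i) :=
  match s i : elem_itv (n i) with inl v => v | inr l => vlo l end.
exists [ffun i => lo i : 'I_(n i)]; apply/forallP => i; rewrite -/(sub_itv _ _) !ffunE /lo.
by case: (s i) => l; rewrite ?sub_itv_refl // sub_itv_facet eqxx.
Qed.

Lemma V_fun_leP (s : cube n) r :
  reflect (forall p, face (V_vertex p) s -> J p <= r) (V_fun J s <= r).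
Proof. exact/fmax_leP/vertex_ex. Qed.

Lemma V_fun_ltP (s : cube n) r :
  reflect (forall p, face (V_vertex p) s -> J p < r) (V_fun J s < r).
Proof. exact/fmax_ltP/vertex_ex. Qed.

Lemma V_fun_mono (t s : cube n) : face t s -> V_fun J t <= V_fun J s.
Proof.
move=> ts; apply/V_fun_leP => p pt.
by move: (lexx (V_fun J s)) => /V_fun_leP; apply; apply: face_trans ts.
Qed.

Hypothesis npos : forall i, (0 < n i)%N.

Lemma top_ex (s : T_cube n) : exists p, face s (T_top p).
Proof.
pose c (i : 'I_d) : 'I_(n i) :=
  match s i : elem_itv (n i).+1 with
  (* A vertex takes the pixel on its left; truncated subtraction gives the leftmost vertex pixel 0,
     so the default of [insubd] is never reached. *)
  | inl v => insubd (Ordinal (npos i)) (v : nat).-1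
  | inr l => l
  end.
exists [ffun i => c i : 'I_(n i)]; apply/forallP => i; rewrite -/(sub_itv _ _) !ffunE /c.
case: (s i) => l; rewrite ?sub_itv_refl // /sub_itv /= val_insubd.
have -> : ((l : nat).-1 < n i)%N by case: l => -[|l] //=.
by rewrite leq_pred leqSpred.
Qed.

Lemma T_fun_leP (s : T_cube n) r :
  reflect (exists2 p, face s (T_top p) & J p <= r) (T_fun J s <= r).
Proof. exact/fmin_leP/top_ex. Qed.

Lemma T_fun_mono (t s : T_cube n) : face t s -> T_fun J t <= T_fun J s.
Proof.
move=> ts; have /T_fun_leP[p sp Jp] := lexx (T_fun J s).
by apply/T_fun_leP; exists p => //; apply: face_trans sp.
Qed.

End Constructions.

Section Dual.
Variables (d : nat) (n : 'I_d -> nat).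
Local Notation mT := (fun i => (padded_size n i).+1).
Implicit Types (s t : cube n) (u w : T_cube (padded_size n)).

(** The cell of the padded T-construction dual to a cell of the V-construction: the
    pixel [l] becomes the interval [l + 1, l + 2] and the interval [l, l + 1] becomes
    the vertex [l + 2] separating the pixels [l] and [l + 1]. *)
Definition dual_itv k (e : elem_itv k) : elem_itv k.+3 :=
  match e with
  | inl l => inr (inord l.+1 : 'I_k.+2)
  | inr l => inl (inord l.+2)
  end.

Lemma itv_hi_ltn k (e : elem_itv k) : (itv_hi e < k)%N.
Proof. by case: e => l /=; [apply: ltn_ord|apply: vhi_subproof]. Qed.

Lemma dual_itv_lo k (e : elem_itv k) : itv_lo (dual_itv e) = (itv_hi e).+1.
Proof.
case: e => l /=; rewrite inordK //; first by rewrite !ltnS ltnW.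
by case: k l => [|k] [l] //= lk; rewrite !ltnS ltnW // ltnW.
Qed.

Lemma dual_itv_hi k (e : elem_itv k) : itv_hi (dual_itv e) = (itv_lo e).+2.
Proof.
case: e => l /=; rewrite inordK //; first by rewrite !ltnS ltnW.
by case: k l => [|k] [l] //= lk; rewrite !ltnS ltnW // ltnW.
Qed.

Lemma dual_itv_edge k (e : elem_itv k) : is_edge (dual_itv e) = ~~ is_edge e.
Proof. by case: e. Qed.

Lemma sub_dual_itv k (e e' : elem_itv k) :
  sub_itv (dual_itv e) (dual_itv e') = sub_itv e' e.
Proof. by rewrite /sub_itv !dual_itv_lo !dual_itv_hi !ltnS andbC. Qed.

Lemma dual_itv_inj k : injective (@dual_itv k).
Proof.
move=> e e' ee'; apply: sub_itv_eq; first by rewrite -sub_dual_itv ee' sub_itv_refl.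
by apply: negb_inj; rewrite -!dual_itv_edge ee'.
Qed.

(** The dual intervals are the vertices 2, ..., k and the edges starting at 1, ..., k. Whatever
    remains lies in one of the two closed padding pixels. *)
Lemma dual_itvP k (e : elem_itv k.+3) :
  (forall e', e != dual_itv e') ->
  sub_itv e (inr (ord0 : 'I_k.+2)) \/ sub_itv e (inr (ord_max : 'I_k.+2)).
Proof.
rewrite /sub_itv /=; case: e => l ne /=.
  have [l1|l1] := leqP l 1; first by left.
  right; apply/andP; split; last by rewrite -ltnS ltn_ord.
  rewrite leqNgt; apply/negP => lk.
  have lk' : (l.-2 < k.-1)%N by case: l l1 {ne} lk => -[|[|l]] //= _ _; case: (k).
  have /eqP[] := ne (inr (Ordinal lk')); congr inl => /=.
  have -> : (l.-2).+2 = l by case: (nat_of_ord l) l1 => [|[]].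
  by rewrite inord_val.
have [l0|l0] := posnP l; first by left; rewrite l0.
right; apply/andP; split; last by rewrite ltn_ord.
rewrite leqNgt; apply/negP => lk.
have lk' : (l.-1 < k)%N by rewrite -ltnS prednK.
have /eqP[] := ne (inl (Ordinal lk')); congr inr => /=.
by rewrite prednK // inord_val.
Qed.

Lemma sub_dual_pixel k (e : elem_itv k) (p : 'I_k.+2) :
  sub_itv (dual_itv e) (inr p) -> (0 < p <= k)%N.
Proof.
rewrite /sub_itv dual_itv_lo dual_itv_hi /= ltnS => /andP[pe ep].
apply/andP; split; first by apply: leq_trans ep.
by apply: leq_trans pe _; exact: itv_hi_ltn.
Qed.

Definition dual s : T_cube (padded_size n) := [ffun i => dual_itv (s i)].

Lemma dual_inj : injective dual.
Proof.
move=> s t st; apply/ffunP => i; apply: dual_itv_inj.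
by have /ffunP/(_ i) := st; rewrite !ffunE.
Qed.

Lemma dual_face s t : face (dual t) (dual s) = face s t.
Proof. by apply: eq_forallb => i; rewrite -!/(sub_itv _ _) !ffunE sub_dual_itv. Qed.

Lemma dual_dim s : (cube_dim (dual s) + cube_dim s)%N = d.
Proof.
rewrite !cube_dimE addnC -[RHS]card_ord -(cardC [set i | is_edge (s i)]).
congr (_ + _)%N; apply: eq_card => i; rewrite !inE ffunE.
exact: dual_itv_edge.
Qed.

Lemma dual_dim_top s : (cube_dim (dual s) == d) = (cube_dim s == 0%N).
Proof.
apply/eqP/eqP => e; last by have := dual_dim s; rewrite e addn0.
by apply: (@addnI (cube_dim (dual s))); rewrite dual_dim addn0 e.
Qed.

Lemma dual_inc s t : inc (dual t) (dual s) = inc s t.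
Proof.
rewrite /inc dual_face; congr andb.
apply/eqP/eqP => e.
  by apply: (@addnI (cube_dim (dual t))); rewrite dual_dim -addSnnS -e dual_dim.
by apply: (@addIn (cube_dim s)); rewrite dual_dim addSnnS -e dual_dim.
Qed.

Lemma dual_up u s : face (dual s) u -> u \in codom dual.
Proof.
move/forallP => su.
have ex i : exists e, u i == dual_itv e.
  apply: contrapT => /forallNP ne.
  have {}ne e' : u i != dual_itv e' by apply/negP/ne.
  have trans (p : 'I_(n i).+2) : sub_itv (u i) (inr p) -> (0 < p <= n i)%N.
    move=> /andP[pu up]; have /andP[lo hi] := su i; rewrite ffunE in lo hi.
    by apply: (@sub_dual_pixel _ (s i)); rewrite /sub_itv (leq_trans pu lo) (leq_trans hi up).
  by case: (dual_itvP ne) => /trans //=; rewrite ltnn.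
have c i := sigW (ex i).
apply/codomP; exists [ffun i => sval (c i)]; apply/ffunP => i.
by rewrite !ffunE; apply/eqP; case: (c i).
Qed.

End Dual.

(** * Transposing boundary matrices along the duality *)

Section Pullback.
Variables (d : nat) (n : 'I_d -> nat).
Local Notation mT := (fun i => (padded_size n i).+1).
Implicit Types (s t : cube n) (u w : T_cube (padded_size n)).

(** Restriction to the dual cells, read as a cochain of the V-complex; its kernel consists of the
    chains supported in the shell. *)
Definition pull_fun (c : chain mT) : chain n := [ffun s => c (dual s)].

Lemma pull_linear : linear pull_fun.
Proof. by move=> a x y; apply/ffunP => s; rewrite !ffunE. Qed.
HB.instance Definition _ :=
  GRing.isLinear.Build 'F_2 (chain mT) (chain n) _ pull_fun pull_linear.

Definition pull : 'Hom(chain mT, chain n) := linfun pull_fun.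

Lemma pullE c s : pull c s = c (dual s).
Proof. by rewrite lfunE /= ffunE. Qed.

Lemma pull_surj (b : chain n) : exists c, pull c = b.
Proof.
exists [ffun u => \sum_(s | dual s == u) b s]; apply/ffunP => s.
rewrite pullE ffunE (big_pred1 s) // => t.
by rewrite (inj_eq (@dual_inj d n)).
Qed.

Lemma limg_pull : limg pull = fullv.
Proof.
apply/vspaceP => b; rewrite memvf; have [c <-] := pull_surj b.
by rewrite memv_img ?memvf.
Qed.

(* Every coface of a dual cell is again a dual cell, since the shell is closed. *)
Lemma pull_boundary c : pull (boundary mT c) = cob n (pull c).
Proof.
apply/ffunP => s; rewrite pullE boundaryE cobE.
transitivity (\sum_(u in [set dual t | t in [set t | inc t s]]) c u).
  apply: eq_bigl => u; apply/idP/imsetP => [su|[t]]; last first.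
    by rewrite inE => ts ->; rewrite dual_inc.
  have /codomP[t ut] : u \in codom (@dual d n) by case/andP: su => /dual_up.
  by exists t; rewrite // inE -dual_inc -ut.
rewrite big_imset /=; last by move=> t t' _ _; apply: dual_inj.
by apply: eq_big => [t|t _]; rewrite ?inE ?pullE.
Qed.

Lemma pull_proj (P : pred (T_cube (padded_size n))) c :
  pull (proj P c) = proj (fun s => P (dual s)) (pull c).
Proof. by apply/ffunP => s; rewrite !(pullE, projE). Qed.

(** [pull] turns the submatrix into one of [cob n], the transpose of a submatrix of [boundary n]. No
    rank is lost: [pull] is surjective, and injective on chains supported in [Q]. *)
Lemma rk_boundary_dual (P Q : pred (T_cube (padded_size n))) :
  (forall u, Q u -> u \in codom (@dual d n)) ->
  rk_boundary P Q = rk_boundary (fun s => Q (dual s)) (fun s => P (dual s)).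
Proof.
move=> Qd; pose F := (proj Q \o (boundary mT \o proj P))%VF.
pose G := (proj (fun s => Q (dual s)) \o (cob n \o proj (fun s => P (dual s))))%VF.
have -> : rk_boundary (fun s => Q (dual s)) (fun s => P (dual s)) = \dim (limg G).
  apply: adjoint_dim => x y; rewrite !comp_lfunE.
  by rewrite proj_adjoint boundary_cob_adjoint proj_adjoint.
have pF : (pull \o F)%VF = (G \o pull)%VF.
  by apply/lfunP => c; rewrite !comp_lfunE pull_proj pull_boundary pull_proj.
rewrite -/(limg G) -[in RHS]limg_pull -limg_comp -pF limg_comp.
rewrite limg_dim_eq //; apply/eqP; rewrite -subv0; apply/subvP => x.
rewrite memv_cap => /andP[/memv_imgP[c _ ->]]; rewrite memv_ker memv0 => /eqP p0.
apply/eqP/ffunP => u; rewrite comp_lfunE projE [RHS]ffunE.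
case: ifP => // /[dup] Qu /Qd/codomP[s us].
have /ffunP/(_ s) := p0; rewrite pullE comp_lfunE projE -us Qu => ->.
by rewrite ffunE.
Qed.

End Pullback.

Section DualFunction.
Variables (R : realType) (d : nat) (n : 'I_d -> nat) (I : grid n -> R) (N : R).
Hypothesis npos : forall i, (0 < n i)%N.
Hypothesis I_lt_N : forall q, I q < N.
Local Notation g := (T_fun (fun p => - pad N I p)).
Local Notation V := (V_fun I).

Let mpos i : (0 < padded_size n i)%N := isT.

Definition pixel (q : grid n) : grid (padded_size n) :=
  [ffun i => inord (q i).+1 : 'I_(n i).+2].

Lemma val_pixel q i : pixel q i = (q i).+1 :> nat.
Proof. by rewrite ffunE inordK // !ltnS ltnW. Qed.

Lemma T_top_pixel q : T_top (pixel q) = dual (V_vertex q).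
Proof. by apply/ffunP => i; rewrite !ffunE. Qed.

Lemma pad_pixel q : pad N I (pixel q) = I q.
Proof.
rewrite /pad; case: pickP => [q' /forallP qq'|/(_ q)]; last first.
  by case/negP; apply/forallP => i; rewrite val_pixel.
congr (I _); apply/ffunP => i; apply: val_inj; apply/eqP.
by have := qq' i; rewrite val_pixel eqSS eq_sym.
Qed.

Lemma pad_le p : pad N I p <= N.
Proof. by rewrite /pad; case: pickP => // q _; apply: ltW. Qed.

Lemma T_fun_dual s : g (dual s) = - V s.
Proof.
apply/eqP; rewrite eq_le; apply/andP; split.
  have [q qs Vq] : exists2 q, face (V_vertex q) s & V s <= I q.
    apply: contrapT => nq; have : V s < V s; last by rewrite ltxx.
    apply/V_fun_ltP => q qs; rewrite ltNge; apply/negP => Vq.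
    by apply: nq; exists q.
  apply/T_fun_leP => //; exists (pixel q); last by rewrite pad_pixel lerN2.
  by rewrite T_top_pixel dual_face.
have /(T_fun_leP _ mpos)[p sp le_p] := lexx (g (dual s)).
apply: le_trans le_p; rewrite lerN2.
have p_bd i : (0 < p i <= n i)%N.
  by apply: (@sub_dual_pixel _ (s i)); have /forallP/(_ i) := sp; rewrite !ffunE.
have lt_p i : ((p i).-1 < n i)%N by have /andP[p0 pn] := p_bd i; rewrite prednK.
pose q : grid n := [ffun i => Ordinal (lt_p i)].
have pq : p = pixel q.
  apply/ffunP => i; apply: val_inj; rewrite /= val_pixel ffunE /=.
  by have /andP[p0 _] := p_bd i; rewrite prednK.
rewrite pq pad_pixel; have /V_fun_leP := lexx (V s); apply.
by rewrite -dual_face -T_top_pixel -pq.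
Qed.

Lemma T_fun_ge u : - N <= g u.
Proof.
apply/fmin_geP => [|p _]; last by rewrite lerN2 pad_le.
exact: top_ex.
Qed.

(** In some direction [u] lies in an outermost pixel; moving any pixel above [u] to that position in
    this direction gives a padding pixel above [u]. *)
Lemma T_fun_nondual u : u \notin codom (@dual d n) -> g u = - N.
Proof.
move=> nu; apply/eqP; rewrite eq_le T_fun_ge andbT.
have [i ni] : exists i, forall e, u i != dual_itv e.
  apply: contrapT => /forallNP nex; case/negP: nu.
  have ex i : exists e, u i == dual_itv e.
    by apply: contrapT => /forallNP ne; apply: (nex i) => e; apply/negP/ne.
  apply/codomP; exists [ffun i => sval (sigW (ex i))]; apply/ffunP => i.
  by rewrite !ffunE; apply/eqP; case: (sigW (ex i)).
have [p0 /forallP up0] := top_ex mpos u.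
have [x [ux x_out]] : exists x : 'I_(n i).+2, sub_itv (u i) (inr x) /\
    forall l : 'I_(n i), x != l.+1 :> nat.
  case: (dual_itvP ni) => ux; [exists ord0|exists ord_max]; split=> // l.
  by rewrite /= eqSS gtn_eqF.
apply/T_fun_leP => //.
exists [ffun j => dfwith (fun j => p0 j) (x : 'I_(padded_size n i)) j].
  apply/forallP => j; rewrite -/(sub_itv _ _) !ffunE.
  have [<-|ij] := eqVneq i j; first by rewrite dfwith_in.
  by rewrite dfwith_out //; have := up0 j; rewrite !ffunE.
rewrite lerN2 /pad; case: pickP => // q /forallP/(_ i).
by rewrite ffunE dfwith_in (negbTE (x_out _)).
Qed.

Lemma V_fun_lt_N s : V s < N.
Proof. by apply/V_fun_ltP => q _. Qed.

Lemma T_fun_gt u : (- N < g u) = (u \in codom (@dual d n)).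
Proof.
case: (boolP (u \in _)) => [/codomP[s ->]|/T_fun_nondual ->]; last by rewrite ltxx.
by rewrite T_fun_dual ltrN2 V_fun_lt_N.
Qed.

End DualFunction.

(** * The essential class and the padding shell *)

Lemma dim_add_line (K : fieldType) (W : vectType K) (U : {vspace W}) (v : W) :
  v \notin U -> \dim (U + <[v]>) = (\dim U).+1.
Proof.
move=> vU; have v0 : v != 0 by apply: contraNneq vU => ->; rewrite mem0v.
rewrite dimv_disjoint_sum ?dim_vline ?v0 ?addn1 //.
apply/eqP; rewrite -subv0; apply/subvP => x /memv_capP[xU /vlineP[a xE]].
have [a0|a0] := eqVneq a 0; first by rewrite xE a0 scale0r mem0v.
by case/negP: vU; rewrite -[v](scalerK a0) -xE memvZ.
Qed.

Section Cycles.
Variables (R : realType) (d : nat) (m : 'I_d -> nat) (f : cube m -> R).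
Implicit Types (c x : chain m).

Lemma mem_cycles k r c :
  c \in cycles f k r <-> boundary m c = 0 /\ c \in sublevel_chains f k r.
Proof.
split=> [/memv_capP[cker cr]|[c0 cr]].
  by split=> //; move: cker; rewrite memv_ker => /eqP.
by apply/memv_capP; split=> //; rewrite memv_ker c0.
Qed.

Lemma mem_boundaries k r c :
  c \in boundaries f k r <->
  exists2 e, e \in sublevel_chains f (k + 1) r & c = boundary m e.
Proof.
split=> [/memv_imgP[e er ->]|[e er ->]]; first by exists e.
exact: memv_img.
Qed.

Lemma proj_dim_boundary (k : int) c :
  boundary m (proj (fun s => (cube_dim s)%:Z == k + 1) c) =
  proj (fun s => (cube_dim s)%:Z == k) (boundary m c).
Proof.
apply: proj_boundary => t s /andP[_ /eqP ->].
by rewrite -addn1 PoszD (inj_eq (addIr _)).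
Qed.

Lemma proj_dim_sublevel k r c : c \in sublevel_chains f k r ->
  proj (fun s => (cube_dim s)%:Z == k) c = c.
Proof.
move/mem_sublevel_chains => cr; apply: proj_id => s.
by apply: contraNeq => /cr/andP[].
Qed.

Hypothesis mpos : forall j, (0 < m j)%N.

Lemma sum_vertices_boundary e : \sum_(s | cube_dim s == 0%N) boundary m e s = 0.
Proof.
transitivity (dot (boundary m e) (vertices m)); last first.
  by rewrite boundary_cob_adjoint cob_vertices dot0.
rewrite big_mkcond; apply: eq_bigr => s _; rewrite [vertices m s]ffunE.
by case: ifP; rewrite ?mulr1 ?mulr0.
Qed.

(** In the full box every cycle of augmentation 0 bounds. In degree 0 one vertex completes these
    cycles, and it is no boundary because its augmentation is 1. This is the essential class. *)
Lemma dim_cycles_total k r M : (forall s, f s <= M) ->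
  \dim (cycles f k r) = (\dim (cycles f k r :&: boundaries f k M) +
    ((k == 0)%R && [exists s, (cube_dim s == 0%N) && (f s <= r)%R]))%N.
Proof.
move=> fM; set Z := cycles f k r; set B := boundaries f k M.
have in_B c : c \in Z -> \sum_(s | cube_dim s == 0%N) c s = 0 -> c \in B.
  case/mem_cycles=> c0 cr; case/(cycle_boundary mpos c0)/memv_imgP => e _ cE.
  apply/mem_boundaries; exists (proj (fun s => (cube_dim s)%:Z == k + 1) e).
    apply/mem_sublevel_chains => s; rewrite projE fM andbT.
    by case: ifP; rewrite ?eqxx.
  by rewrite proj_dim_boundary -cE (proj_dim_sublevel cr).
have ZB : (forall c, c \in Z -> \sum_(s | cube_dim s == 0%N) c s = 0) ->
    (Z :&: B)%VS = Z.
  by move=> sum0; apply/capv_idPl/subvP => c cZ; apply: in_B (sum0 c cZ).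
case: (boolP (_ && _)) => [/andP[/eqP k0 /existsP[s0 /andP[s00 fs0]]]|nk].
  have cell_s0 : \sum_(s | cube_dim s == 0%N) cell_chain s0 s = 1.
    rewrite (bigD1 s0) //= ffunE eqxx big1 ?addr0 // => s /andP[_ /negbTE ss0].
    by rewrite ffunE ss0.
  have s0Z : cell_chain s0 \in Z.
    apply/mem_cycles; split; last first.
      apply/mem_sublevel_chains => s; rewrite ffunE.
      by case: (s =P s0) => [->|//]; rewrite k0 (eqP s00) eqxx.
    apply/ffunP => t; rewrite boundaryE [RHS]ffunE big1 // => s /andP[_ /eqP st].
    by rewrite ffunE; case: eqP st => // ->; rewrite (eqP s00).
  rewrite addn1 -(@dim_add_line _ _ _ (cell_chain s0)).
    congr (\dim _); apply/eqP; rewrite eqEsubv subv_add capvSl -memvE s0Z !andbT.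
    apply/subvP => c cZ; pose a := \sum_(s | cube_dim s == 0%N) c s.
    rewrite -(subrK (a *: cell_chain s0) c) memv_add ?memvZ ?memv_line //.
    have caZ : c - a *: cell_chain s0 \in Z by rewrite rpredB ?memvZ.
    rewrite memv_cap caZ; apply: in_B caZ _.
    under eq_bigr => s _ do rewrite [_ s]ffunE.
    rewrite big_split /= -/a.
    have -> : \sum_(s | cube_dim s == 0%N) (- (a *: cell_chain s0)) s = - a.
      rewrite -[in RHS](mulr1 a) -cell_s0 mulr_sumr -sumrN.
      by apply: eq_bigr => s _; rewrite !ffunE.
    exact: subrr.
  apply/negP => /memv_capP[_ /mem_boundaries[e _ s0E]].
  by have := sum_vertices_boundary e; rewrite -s0E cell_s0 => /eqP; rewrite oner_eq0.
rewrite addn0 ZB // => c /mem_cycles[_ /mem_sublevel_chains cr].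
apply: big1 => s s0; apply/eqP; apply: contraNT nk => /cr/andP[/eqP <- fs].
by rewrite (eqP s0) eqxx; apply/existsP; exists s; rewrite s0.
Qed.

End Cycles.

Section Duality.
Variables (R : realType) (d : nat) (n : 'I_d -> nat) (I : grid n -> R) (N : R).
Hypothesis npos : forall i, (0 < n i)%N.
Hypothesis d_gt0 : (0 < d)%N.
Hypothesis I_lt_N : forall q, I q < N.
Local Notation mT := (fun i => (padded_size n i).+1).
Local Notation g := (T_fun (fun p => - pad N I p)).
Local Notation V := (V_fun I).
Local Notation minI := (fmin predT I).

Implicit Types (a c x : chain mT) (s : cube n) (u : cube mT) (v M : R).

Let mpos i : (0 < padded_size n i)%N := isT.
Let mTpos i : (0 < mT i)%N := isT.
Let g_mono := @T_fun_mono R d (padded_size n) (fun p => - pad N I p) mpos.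

Lemma grid_ex : exists q : grid n, predT q.
Proof. by exists [ffun i => Ordinal (npos i)]. Qed.

Lemma fmin_le_V s : minI <= V s.
Proof.
have [p ps] := vertex_ex s; have /V_fun_leP/(_ p ps) := lexx (V s).
by apply: le_trans; apply: (elimT (fmin_geP I minI grid_ex) (lexx _) p isT).
Qed.

Lemma V_vertexE q : V (V_vertex q) = I q.
Proof.
apply/eqP; rewrite eq_le; apply/andP; split; last first.
  by have /V_fun_leP := lexx (V (V_vertex q)); apply; apply: face_refl.
apply/V_fun_leP => p /forallP pq; suff -> : p = q by [].
apply/ffunP => i; have := pq i; rewrite -/(sub_itv _ _) => /sub_itv_eq.
by rewrite !ffunE => /(_ erefl) [].
Qed.

Lemma dim_V_vertex (q : grid n) : @cube_dim d n (V_vertex q) = 0%N.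
Proof. by rewrite cube_dimE; apply: eq_card0 => i; rewrite !inE ffunE. Qed.

Lemma fmin_ex : exists q, I q = minI.
Proof. by have [q _ qE] := fmin_attained I grid_ex; exists q. Qed.

Lemma T_le_fmin u : g u <= - minI.
Proof.
case: (boolP (u \in codom (@dual d n))) => [/codomP[s ->]|/T_fun_nondual ->] //.
  by rewrite T_fun_dual // lerN2 fmin_le_V.
by have [q <-] := fmin_ex; rewrite lerN2 ltW.
Qed.

Lemma pull_eq0_sublevel k c : (forall u, c u != 0 -> (cube_dim u)%:Z = k) ->
  pull n c = 0 -> c \in sublevel_chains g k (- N).
Proof.
move=> cd /ffunP c0; apply/mem_sublevel_chains => u cu; rewrite (cd u cu) eqxx.
rewrite T_fun_nondual ?lexx //; apply/negP => /codomP[s us].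
by have := c0 s; rewrite pullE -us ffunE => /eqP; rewrite (negbTE cu).
Qed.

Lemma sublevel_pull_eq0 k c : c \in sublevel_chains g k (- N) -> pull n c = 0.
Proof.
move/mem_sublevel_chains => cN; apply/ffunP => s; rewrite pullE [RHS]ffunE.
apply/eqP; apply: contraT => /cN/andP[_].
by rewrite leNgt T_fun_gt // codom_f.
Qed.

(** The cycles of the shell that bound at level [v]: the sub-level of [g] at -N is precisely the
    shell. *)
Let W k v : {vspace chain mT} := (cycles g k (- N) :&: boundaries g k v)%VS.

Lemma shell_boundary k v a x : - N <= v -> x \in cycles g k (- N) ->
  pull n a = 0 -> boundary mT a = x -> x \in W k v.
Proof.
move=> Nv xZ a0 ax; have /mem_cycles[_ xN] := xZ.
apply/memv_capP; split=> //; apply/mem_boundaries.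
(* The filling [a] may be inhomogeneous, since nothing is known of the degree of the cochains it is
   built from; its part of degree k + 1 has the same boundary. *)
exists (proj (fun u => (cube_dim u)%:Z == k + 1) a); last first.
  by rewrite proj_dim_boundary ax (proj_dim_sublevel xN).
apply: (subvP (sublevel_chainsS _ _ Nv)); apply: pull_eq0_sublevel => [u|].
  by rewrite projE; case: ifP => [/eqP|]; rewrite ?eqxx.
by rewrite pull_proj a0 linear0.
Qed.

Lemma shell_boundary_mono k v M : v <= M -> (W k v <= W k M)%VS.
Proof. by move=> vM; apply/capvS/boundariesS. Qed.

(** The sum of all d-cubes; its pullback is a cocycle, so its boundary lies in the shell. *)
Let X : chain mT := [ffun u => (cube_dim u == d)%:R].

Lemma pull_X : pull n X = vertices n.
Proof.
apply/ffunP => s; rewrite pullE !ffunE; congr (_%:R); congr nat_of_bool.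
exact: dual_dim_top.
Qed.

Lemma X_boundary_shell M : (forall u, g u <= M) -> boundary mT X \in W (d%:Z - 1) M.
Proof.
move=> gM.
have XM : X \in sublevel_chains g (d%:Z - 1 + 1) M.
  apply/mem_sublevel_chains => u; rewrite ffunE gM subrK andbT.
  by case: (cube_dim u =P d) => [->|]; rewrite ?eqxx.
have BM : boundary mT X \in boundaries g (d%:Z - 1) M by apply/mem_boundaries; exists X.
apply/memv_capP; split=> //; apply/mem_cycles; split; first exact: boundary_boundary.
apply: pull_eq0_sublevel => [u Xu|].
  by have /andP[/eqP] := boundaries_supp g_mono BM Xu.
by rewrite pull_boundary pull_X cob_vertices.
Qed.

(** [X] is the only chain of d-cubes with its boundary, so a filling needs every d-cube, including
    the one over a darkest pixel, which enters only at -min I. *)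
Lemma X_boundary_notin v : v < - minI -> boundary mT X \notin W (d%:Z - 1) v.
Proof.
move=> vmin; apply/negP => /memv_capP[_ /mem_boundaries[c]]; rewrite subrK.
move=> /mem_sublevel_chains cv Xc.
have Xc0 : X - c = 0.
  apply: (top_cycle_eq0 mTpos d_gt0) => [u|]; last by rewrite linearB /= Xc subrr.
  rewrite !ffunE; case: (cube_dim u =P d) => // ud; rewrite add0r oppr_eq0.
  by case/cv/andP=> /eqP[] /ud.
have [q qE] := fmin_ex; pose u := dual (V_vertex q).
have ud : cube_dim u = d by apply/eqP; rewrite dual_dim_top dim_V_vertex.
have cu : c u != 0.
  have /ffunP/(_ u) := Xc0; rewrite !ffunE ud eqxx => /eqP.
  by rewrite subr_eq0 => /eqP <-; rewrite oner_eq0.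
have /andP[_] := cv u cu.
by rewrite T_fun_dual // V_vertexE qE leNgt vmin.
Qed.

(* A chain whose boundary lies in the shell pulls back to a cocycle of the V-complex:
   in positive degree this is a coboundary, in degree 0 a multiple of [vertices n],
   which is the pullback of [X]. *)
Lemma dim_shell_boundary k v M : - N <= v -> v <= M -> (forall u, g u <= M) ->
  \dim (W k M) = (\dim (W k v) + ((k == (d%:Z - 1)%R) && (v < - minI)%R))%N.
Proof.
move=> Nv vM gM.
have lift x : x \in W k M -> exists c, [/\ c \in sublevel_chains g (k + 1) M,
    x = boundary mT c & cob n (pull n c) = 0].
  move=> /memv_capP[/mem_cycles[_ xN] /mem_boundaries[c cM xE]]; exists c; split=> //.
  by rewrite -pull_boundary -xE (sublevel_pull_eq0 xN).
have sup c s : c \in sublevel_chains g (k + 1) M -> pull n c s != 0 ->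
    (cube_dim (dual s))%:Z = k + 1.
  by move=> /mem_sublevel_chains cM; rewrite pullE => /cM/andP[/eqP].
case: eqP => [kd|kd]; last first.
  rewrite addn0; congr (\dim _); apply/eqP.
  rewrite eqEsubv (shell_boundary_mono k vM) andbT; apply/subvP => x xW.
  have /memv_capP[xZ _] := xW.
  have [c [cM xE pc0]] := lift x xW.
  have [b bE] := cocycle_exact npos pc0.
  have [e eb] := pull_surj b.
  (* Adding [boundary mT e] leaves the boundary x unchanged and cancels the pullback, which makes
     the filling one inside the shell. *)
  apply: (@shell_boundary _ _ (c + boundary mT e)) => //; last first.
    by rewrite linearD /= boundary_boundary addr0.
  rewrite linearD /= pull_boundary eb.
  suff {1}-> : pull n c = cob n b by exact: addxx_chain.
  (* The constant part is the value of [c] at the dual of the base vertex, a d-cube; it is 0 since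
     [c] has degree k + 1, different from d. *)
  apply/ffunP => s; rewrite bE (_ : pull n c _ = 0) ?if_same ?add0r //.
  apply/eqP; apply: contraT => /(sup _ _ cM); set s0 := [ffun _ => _].
  have s00 : cube_dim s0 = 0%N.
    by rewrite cube_dimE; apply: eq_card0 => i; rewrite !inE ffunE.
  have := dual_dim s0; rewrite s00 addn0 => -> dk.
  by case: kd; rewrite dk addrK.
(* From level -min I on, all cells are present and nothing further can be filled. *)
case: ltP => [vmin|minv] /=; last first.
  rewrite addn0; congr (\dim _); apply/eqP.
  rewrite eqEsubv (shell_boundary_mono k vM) andbT capvS ?subvv //.
  apply/subvP => x /mem_boundaries[c /mem_sublevel_chains cM ->].
  apply/mem_boundaries; exists c => //; apply/mem_sublevel_chains => u /cM/andP[-> _].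
  by rewrite (le_trans (T_le_fmin u)).
have XW : boundary mT X \in W k M by rewrite kd X_boundary_shell.
rewrite addn1 -(@dim_add_line _ _ _ (boundary mT X)); last by rewrite kd X_boundary_notin.
congr (\dim _); apply/eqP; rewrite eqEsubv subv_add (shell_boundary_mono k vM).
rewrite -memvE XW !andbT; apply/subvP => x xW.
have /memv_capP[xZ _] := xW.
have [c [cM xE pc0]] := lift x xW.
have [b bE] := cocycle_exact npos pc0.
set a := pull n c _ in bE.
have pcE : pull n c = a *: vertices n.
  apply/ffunP => s; rewrite [RHS]ffunE [vertices n s]ffunE.
  have [s0|s0] := eqVneq (cube_dim s) 0%N.
    rewrite bE s0 eqxx cobE big1 ?addr0 => [|t /andP[_]]; last by rewrite s0.
    by rewrite [RHS]mulr1.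
  rewrite [RHS]mulr0; apply/eqP; apply: contraT => /(sup _ _ cM).
  rewrite kd subrK => -[sd]; case/eqP: s0.
  by apply: (@addnI (cube_dim (dual s))); rewrite dual_dim addn0 sd.
have -> : x = boundary mT (c - a *: X) + a *: boundary mT X.
  by rewrite linearB linearZ /= -xE subrK.
rewrite memv_add ?memvZ ?memv_line //.
apply: (@shell_boundary _ _ (c - a *: X)) => //.
  have /memv_capP[XZ _] := XW.
  by rewrite linearB linearZ /= -xE rpredB ?memvZ.
by rewrite linearB linearZ /= pull_X pcE subrr.
Qed.

End Duality.

(** * Duality of the diagrams *)

Lemma rk_boundary_total (R : realType) d (m : 'I_d -> nat) (f : cube m -> R) k r :
  rk_boundary (fun t => ((cube_dim t)%:Z == k + 1) && (f t <= r)) predT =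
  \dim (boundaries f k r).
Proof.
rewrite /rk_boundary !limg_comp limg_proj_sublevel.
have -> : proj (m := m) predT = \1%VF by apply/lfunP => c; rewrite proj_id ?lfunE.
by rewrite lim1g.
Qed.

Section Pairing.
Variables (R : realType) (d : nat) (n : 'I_d -> nat) (I : grid n -> R) (N : R).
Hypothesis npos : forall i, (0 < n i)%N.
Hypothesis d_gt0 : (0 < d)%N.
Hypothesis I_lt_N : forall q, I q < N.
Local Notation mT := (fun i => (padded_size n i).+1).
Local Notation g := (T_fun (fun p => - pad N I p)).
Local Notation V := (V_fun I).
Local Notation minI := (fmin predT I).

Let mpos i : (0 < padded_size n i)%N := isT.
Let g_mono := @T_fun_mono R d (padded_size n) (fun p => - pad N I p) mpos.
Let V_mono := @V_fun_mono R d n I.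

(** The columns of degree d - k on the T side are the rows of degree [k] on the V side. That degree
    need not be imposed there, since incidence with a cell of dimension k + 1 forces it. *)
Lemma rk_boundary_T (k : int) (u v : R) (S Q : pred (cube n)) : - N <= u ->
  (forall c, (u < - V c) = S c) -> (forall c, (- V c <= v) = Q c) ->
  rk_boundary (fun c : cube mT => ((cube_dim c)%:Z == d%:Z - k - 1 + 1) && (g c <= v))
    (fun c : cube mT => u < g c) =
  rk_boundary (fun c => ((cube_dim c)%:Z == k + 1) && S c) Q.
Proof.
move=> Nu Su Qv; rewrite rk_boundary_dual => [|c uc]; last first.
  by rewrite -(T_fun_gt I_lt_N) (le_lt_trans Nu).
apply: eq_rk_boundary => t s /andP[_ /eqP ts].
rewrite !T_fun_dual // Su Qv [RHS]andbAC andbC; congr andb; congr andb.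
by have := dual_dim t; lia.
Qed.

(** Here [u] and [v] stand for levels just below -s and -r. The rank identity is used twice for V,
    with ends s and N, and four times for T, with starts u and -N and ends v and M; all ranks and
    dimensions of boundary spaces cancel, and the comparison of shell cycles settles the two terms
    with start -N. *)
Lemma dim_pairing (k : int) (r s u v M : R) :
  - N <= u -> u <= v -> v <= M -> (forall c, g c <= M) ->
  (forall c : cube n, (u < - V c) = (V c <= s)) ->
  (forall c : cube n, (- V c <= v) = (r < V c)) ->
  (\dim (cycles V k r :&: boundaries V k N) +
   \dim (cycles g (d%:Z - k - 1) u :&: boundaries g (d%:Z - k - 1) v) +
   ((k == 0)%R && (v < - minI)%R) =
   \dim (cycles V k r :&: boundaries V k s) +
   \dim (cycles g (d%:Z - k - 1) u :&: boundaries g (d%:Z - k - 1) M))%N.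
Proof.
move=> Nu uv vM gM Su Qv.
have VN (c : cube n) : V c <= N by apply/ltW/V_fun_lt_N.
have SN (c : cube n) : (- N < - V c) = (V c <= N) by rewrite VN ltrN2 V_fun_lt_N.
have QM (c : cube n) : (- V c <= M) = predT c by have := gM (dual c); rewrite T_fun_dual // => ->.
have := dim_cycles_boundaries g_mono (d%:Z - k - 1) u v.
rewrite (rk_boundary_T _ Nu Su Qv).
have := dim_cycles_boundaries g_mono (d%:Z - k - 1) u M.
rewrite (rk_boundary_T _ Nu Su QM) rk_boundary_total.
have := dim_cycles_boundaries g_mono (d%:Z - k - 1) (- N) v.
rewrite (rk_boundary_T _ (lexx _) SN Qv).
have := dim_cycles_boundaries g_mono (d%:Z - k - 1) (- N) M.
rewrite (rk_boundary_T _ (lexx _) SN QM) rk_boundary_total.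
have := dim_cycles_boundaries V_mono k r s.
have := dim_cycles_boundaries V_mono k r N.
have := dim_shell_boundary npos d_gt0 I_lt_N (d%:Z - k - 1) (le_trans Nu uv) vM gM.
have -> : (d%:Z - k - 1 == d%:Z - 1) = (k == 0) by lia.
lia.
Qed.

End Pairing.

(** * Existence of diagrams *)

Section DgmExistence.
Variables (R : realType) (d : nat) (m : 'I_d -> nat) (f : cube m -> R).

Lemma cycles_eq0 k r : (forall s, ((cube_dim s)%:Z == k) && (f s <= r) = false) ->
  cycles f k r = 0%VS.
Proof.
move=> nk; apply/eqP; rewrite -subv0; apply/subvP => c /mem_cycles[_].
move=> /mem_sublevel_chains cr; rewrite memv0; apply/eqP/ffunP => s; rewrite [RHS]ffunE.
by apply/eqP; apply: contraT => /cr; rewrite nk.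
Qed.

Lemma tagged_filter (T : Type) (D : int -> seq T) (ks : seq int) k : uniq ks ->
  [seq x.2 | x <- [seq x <- flatten [seq [seq (j, y) | y <- D j] | j <- ks] | x.1 == k]] =
  if k \in ks then D k else [::].
Proof.
elim: ks => //= j ks IH /andP[jks /IH {}IH]; rewrite filter_cat map_cat IH inE.
have -> : [seq x <- [seq (j, y) | y <- D j] | x.1 == k] =
          if k == j then [seq (j, y) | y <- D j] else [::].
  rewrite filter_map; case: (eqVneq k j) => [->|kj].
    by rewrite (eq_filter (a2 := predT)) ?filter_predT // => y /=; rewrite eqxx.
  by rewrite (eq_filter (a2 := pred0)) ?filter_pred0 // => y /=; rewrite eq_sym (negbTE kj).
case: (eqVneq k j) => [->|_] //=.
by rewrite (negbTE jks) cats0 -map_comp map_id.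
Qed.

(** Outside the degrees 0, ..., d there are no cycles and hence no bars, so concatenating finitely
    many decompositions gives the whole diagram. *)
Lemma dgm_exists : (forall t s, face t s -> f t <= f s) -> exists D, is_dgm f D.
Proof.
move=> f_mono.
have /choice[D DP] k := homology_decomposition (boundaries_sub_cycles f_mono k).
pose ks := [seq Posz j | j <- iota 0 d.+1].
exists (flatten [seq [seq (k, y) | y <- D k] | k <- ks]); split.
  move=> x /flatten_mapP[k _ /mapP[y yD ->]] /=.
  by have [ne _ _] := DP k; apply: ne.
move=> k; have [_ D0 isoD] := DP k.
rewrite (map_comp (@pm_interval R) snd) tagged_filter; last first.
  by rewrite map_inj_uniq ?iota_uniq // => i j [].
case: ifPn => // kks; rewrite D0 // in isoD => r.
apply: cycles_eq0 => s; apply/negP => /andP[/eqP sk _]; case/negP: kks.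
rewrite -sk map_f // mem_iota /= add0n ltnS /cube_dim.
by rewrite (leq_trans (max_card _)) ?card_ord.
Qed.

Lemma Dgm_is_dgm : (forall t s, face t s -> f t <= f s) -> is_dgm f (Dgm f).
Proof. by move=> /dgm_exists[D DP]; apply: (xgetPex [::]); exists D. Qed.

Lemma dgm_birth_ge D (a : R) : is_dgm f D -> (forall s, a <= f s) ->
  {in D, forall x, a <= x.2.1}.
Proof.
move=> DP fa x xD; rewrite leNgt; apply/negP => xa.
have := dgm_count x.1 DP (lexx x.2.1).
rewrite cycles_eq0 => [|s]; last first.
  by rewrite andbC; case: leP => // fx; have := le_lt_trans (le_trans (fa s) fx) xa; rewrite ltxx.
rewrite dimv0 sub0n => /eqP; rewrite -leqn0 leqNgt -has_count; case/hasP.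
by exists x => //; rewrite /alive eqxx lexx /=; case: DP => /(_ x xD).
Qed.

End DgmExistence.

Theorem theorem6p2 (R : realType) (d : nat) (n : 'I_d -> nat)
    (I : grid n -> R) (N : R) :
  (0 < d)%N -> (forall i : 'I_d, (0 < n i)%N) -> fmax predT I < N ->
  perm_eq (Dgm_fin (V_fun I))
    (rem (0 : int, (fmin predT I, N%:E))
       [seq (d%:Z - x.1 - 1, (- fine x.2.2, (- x.2.1)%:E))
          | x <- Dgm_fin (T_fun (fun p => - pad N I p))]) /\
  perm_eq (Dgm_inf (V_fun I)) [:: (0 : int, (fmin predT I, +oo%E))].
Proof.
(* The final count: [zV], [zT] are dimensions of cycle spaces, [bN], [bs], [tv], [tM] those of their
   intersections with boundaries, [c] counts the flipped bars and [e] the essential one. The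
   inequalities make the truncated subtractions exact. *)
have arith (zV bN bs zT tv tM c e : nat) : (tM <= zT)%N -> (tv <= zT)%N ->
    (bs <= zV)%N -> (zT - tv = c + (zT - tM))%N -> zV = (bN + e)%N ->
    (bN + tv + e = bs + tM)%N -> (e + (zV - bs) = e + c)%N by lia.
have flipE (j k : int) : (d%:Z - j - 1 == k) = (j == d%:Z - k - 1) by lia.
move=> d_gt0 npos maxI.
have I_lt_N q : I q < N by apply: (elimT (fmax_ltP I N _) maxI q isT); exists q.
set V := V_fun I; set g := T_fun _; set minI := fmin predT I.
have gmin c : - N <= g c by apply: T_fun_ge.
have Vdgm : is_dgm V (Dgm V) by apply/Dgm_is_dgm/V_fun_mono.
have Tdgm : is_dgm g (Dgm g) by apply/Dgm_is_dgm/T_fun_mono.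
have minN : minI < N by have [q qE] := fmin_ex I npos; rewrite /minI -qE.
pose x0 : int * bar R := (0, (minI, N%:E)).
pose xoo : int * bar R := (0, (minI, +oo%E)).
pose flip (x : int * bar R) : int * bar R :=
  (d%:Z - x.1 - 1, (- fine x.2.2, (- x.2.1)%:E)).
set S := [seq _ | x <- _].
have exV r : [exists s : cube n, (cube_dim s == 0%N) && (V s <= r)] = (minI <= r).
  apply/existsP/idP => [[s /andP[_]]|le_r]; first exact/le_trans/fmin_le_V.
  have [q qE] := fmin_ex I npos; exists (V_vertex q).
  by rewrite dim_V_vertex /V V_vertexE qE le_r.
have countS k r s : count (alive k r s) S =
    count (fun x => (x.2.2 < +oo)%E && alive k r s (flip x)) (Dgm g).
  by rewrite /S count_map /Dgm_fin count_filter; apply: eq_count => x /=; rewrite andbC.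
(* An additive form of both claims. It avoids [rem], which does nothing on an absent bar, before
   [x0] is known to occur in [S]. *)
have perm : perm_eq (x0 :: Dgm V) (xoo :: S).
  apply: bars_perm_eq.
  - by move=> x; rewrite inE => /predU1P[->|]; [rewrite lte_fin|case: Vdgm => + _; apply].
  - move=> x; rewrite inE => /predU1P[->|/mapP[y + ->]] /=; first exact: ltry.
    rewrite mem_filter => /andP[yfin yD]; have [/(_ y yD) + _] := Tdgm.
    by case: y.2.2 yfin => [q| |] //= _; rewrite !lte_fin ltrN2.
  - move=> k r s rs /=.
    have -> : alive k r s x0 = [&& k == 0, minI <= r & s < N].
      by rewrite /alive /= lte_fin eq_sym.
    have -> : alive k r s xoo = (k == 0) && (minI <= r).
      by rewrite /alive /= ltry andbT eq_sym.
    rewrite countS (dgm_count k Vdgm rs).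
    have [sN|Ns] := ltP s N; last first.
      (* For s >= N all of V is present, so only the essential class survives; flipped bars have
         ended, since T-bars are born at -N or later. *)
      rewrite !andbF add0n (@dim_cycles_total _ _ _ V npos k r s) ?exV; last first.
        by move=> c; apply: le_trans Ns; apply/ltW/V_fun_lt_N.
      rewrite addKn [X in _ = (_ + X)%N](_ : _ = 0%N) ?addn0 //.
      apply/eqP; rewrite -leqn0 leqNgt -has_count; apply/hasPn => x xD.
      rewrite /alive /= lte_fin ltrNr; apply/negP => /and4P[_ _ _] xs.
      have := lt_le_trans xs (le_trans _ (dgm_birth_ge Tdgm gmin xD)).
      by rewrite lerN2 Ns ltxx => /(_ isT).
    rewrite andbT; set e := (k == 0) && (minI <= r).
    (* All levels that must not fall into the gaps below -s and -r; [- minI] is included to read v <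
       - minI as minI <= r. *)
    pose L := - minI :: codom g ++ [seq x.2.1 | x <- Dgm g] ++ [seq fine x.2.2 | x <- Dgm g].
    have lt_Ns : - N < - s by rewrite ltrN2.
    have [u [Nu us uL]] := seq_gap L lt_Ns.
    have lt_ur : u < - r by rewrite (lt_le_trans us) ?lerN2.
    have [v [uv vr vL]] := seq_gap L lt_ur.
    have [M [vM ML]] := seq_ub L v.
    have uE x : x \in L -> (x <= u) = (x < - s).
      by move=> xL; apply/idP/idP => [/le_lt_trans -> //|]; apply: uL.
    have vE x : x \in L -> (x <= v) = (x < - r).
      by move=> xL; apply/idP/idP => [/le_lt_trans -> //|]; apply: vL.
    have gL c : g c \in L by rewrite inE mem_cat codom_f orbT.
    have VL c : - V c \in L by rewrite -(T_fun_dual I N).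
    have gM c : g c <= M by apply: ML.
    have Su (c : cube n) : (u < - V c) = (V c <= s) by rewrite ltNge uE // -leNgt lerN2.
    have Qv (c : cube n) : (- V c <= v) = (r < V c) by rewrite vE // ltrN2.
    have em : (v < - minI) = (minI <= r) by rewrite ltNge vE ?mem_head // -leNgt lerN2.
    have := dim_pairing npos d_gt0 I_lt_N k Nu uv vM gM Su Qv.
    rewrite em -/e; set k' := d%:Z - k - 1.
    have := @dim_cycles_total _ _ _ V npos k r N (fun c => ltW (V_fun_lt_N I_lt_N c)).
    rewrite exV -/e.
    (* A finite T-bar ends by M and is alive on [u, v] exactly when its flip is alive on [r, s]; an
       infinite one alive at u is still alive at M. *)
    have : count (alive k' u v) (Dgm g) =
        (count (fun x => (x.2.2 < +oo)%E && alive k r s (flip x)) (Dgm g) +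
         count (alive k' u M) (Dgm g))%N.
      apply: count_addn => -[j [p q]] xD; rewrite /alive /flip /=.
      have pL : p \in L by rewrite inE !mem_cat (map_f (fun x => x.2.1) xD) !orbT.
      have qL : fine q \in L by rewrite inE !mem_cat (map_f (fun x => fine x.2.2) xD) !orbT.
      have [/(_ _ xD) + _] := Tdgm.
      rewrite flipE -/k'.
      rewrite uE //; case: q {xD} qL => [q| |] //= qL _.
        rewrite !lte_fin ltry (ltNge M) ML // ltrNr !andbF addn0 /=.
        rewrite (ltNge v) vE // -leNgt lerNl.
        by case: (j == k') => //=; rewrite andbC.
      by rewrite !ltry !andbT.
    rewrite (dgm_count k' Tdgm uv) (dgm_count k' Tdgm (le_trans uv vM)).
    have := dimvS (capvSl (cycles V k r) (boundaries V k s)).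
    have := dimvS (capvSl (cycles g k' u) (boundaries g k' v)).
    have := dimvS (capvSl (cycles g k' u) (boundaries g k' M)).
    exact: arith.
(* Since [x0] differs from [xoo], the permutation can only match it with an entry of [S]. *)
have xS : x0 \in S.
  by have := perm_mem perm x0; rewrite !inE eqxx /= => /esym/orP[/eqP[]|].
have perm' : perm_eq (Dgm V) (xoo :: rem x0 S).
  rewrite -(perm_cons x0) (perm_trans perm) //.
  rewrite -(permPr (permEl (perm_catCA [:: xoo] [:: x0] _))) /= perm_cons.
  exact: perm_to_rem.
have remfin x : x \in rem x0 S -> (x.2.2 < +oo)%E.
  by move=> /mem_rem/mapP[y _ ->]; apply: ltry.
split.
  apply: (perm_trans (perm_filter _ perm')); move=> /=.
  suff -> : [seq x <- rem x0 S | (x.2.2 < +oo)%E] = rem x0 S by exact: perm_refl.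
  exact/all_filterP/allP.
apply: (perm_trans (perm_filter _ perm')); rewrite /= ?eqxx.
suff -> : [seq x <- rem x0 S | x.2.2 == +oo%E] = [::] by exact: perm_refl.
apply/eqP; rewrite -(negbK (_ == _)) -has_filter; apply/hasPn => x /remfin.
by case: x.2.2.
Qed.
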